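(* There exist initial data $u_0\in L^\infty(\mathbb{R})$ for Burgers' equation such that $\omega_0(u_0)$ contains a solution $v(t,x)$ that is neither a constant nor a shock; in fact $v$ describes the merging of a pair of shocks into a single shock. That is, there exist $u_0\in L^\infty(\mathbb{R})$ and an entire solution $v:\mathbb{R}\times\mathbb{R}\to\mathbb{R}$ of Burgers' equation such that $v(t,\cdot)\in\omega_0(u_0)$ for all $t\in\mathbb{R}$, such that $v(t,\cdot)$ is neither a constant nor a translate of a viscous shock profile $\phi_{\beta,\alpha}$ with $\alpha<\beta$, and such that $v$ is a merger of two shocks into a single shock.
   Context: Burgers' equation is $\partial_t u+u\,\partial_x u=\partial_x^2 u$ on $\mathbb{R}$. For $u_0\in L^\infty(\mathbb{R})$, $\mathcal{S}_t(u_0)=u(t,\cdot)$ denotes the unique global solution $u\in C^0((0,+\infty),L^\infty(\mathbb{R}))$ with $u(t,\cdot)\to u_0$ weak-$*$ in $L^\infty(\mathbb{R})$ as $t\to0+$. The $\omega$-limit set in the fixed frame is $$\omega_0(u_0)=\{v\in L^\infty(\mathbb{R}) \mid \exists\, t_k\to+\infty \text{ such that } \mathcal{S}_{t_k}(u_0)\to v \text{ in } L^\infty_{\mathrm{loc}}(\mathbb{R})\},$$ where convergence in $L^\infty_{\mathrm{loc}}(\mathbb{R})$ is uniform convergence on compact intervals. An entire solution is a solution defined for all $t\in\mathbb{R}$. For $\alpha<\beta$ the viscous shock profile of Burgers' equation is $\phi_{\beta,\alpha}(y)=c-\delta\tanh(\delta y/2)$ with $c=(\alpha+\beta)/2$ and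 $\delta=(\beta-\alpha)/2$, and $\phi_{\beta,\alpha}(x-ct)$ is a traveling wave solution. An entire solution $v$ is said to be a merger of two shocks into a single shock if there are $\alpha<\gamma<\beta$ and $x_0,x_1,x_2\in\mathbb{R}$ such that $\sup_{x}|v(t,x)-\phi_{\beta,\alpha}(x-\tfrac{\alpha+\beta}{2}t-x_0)|\to0$ as $t\to+\infty$ and $\sup_{x}|v(t,x)-\phi_{\beta,\gamma}(x-\tfrac{\beta+\gamma}{2}t-x_1)-\phi_{\gamma,\alpha}(x-\tfrac{\gamma+\alpha}{2}t-x_2)+\gamma|\to0$ as $t\to-\infty$. *)

(* Defs.v *)
From HB Require Import structures.
From mathcomp Require Import all_boot all_order all_algebra.
From mathcomp Require Import all_classical all_reals all_analysis.

Set Implicit Arguments.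
Unset Strict Implicit.
Unset Printing Implicit Defensive.

Import Order.TTheory GRing.Theory Num.Theory.
Import numFieldNormedType.Exports.

Local Open Scope classical_set_scope.
Local Open Scope ring_scope.

(* A function of time and space is curried, time first: [u t x]. *)

Definition dt (R : realType) (u : R -> R -> R) : R -> R -> R :=
  fun t x => derive1 (u ^~ x) t.

Definition dx (R : realType) (u : R -> R -> R) : R -> R -> R :=
  fun t x => derive1 (u t) x.

(* Class C^{1,2} (one derivative in time, two in space) on I x R, for I an
   open set of times. *)
Definition C12_on (R : realType) (I : set R) (u : R -> R -> R) : Prop :=
  forall t x, I t ->
    [/\ derivable (u ^~ x) t 1, derivable (u t) x 1 & derivable (dx u t) x 1] /\
    [/\ {for (t, x), continuous (fun p : R * R => u p.1 p.2)},
        {for (t, x), continuous (fun p : R * R => dt u p.1 p.2)},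
        {for (t, x), continuous (fun p : R * R => dx u p.1 p.2)} &
        {for (t, x), continuous (fun p : R * R => dx (dx u) p.1 p.2)}].

Definition Linfty (R : realType) (f : R -> R) : Prop :=
  f \in Lfun (@lebesgue_measure R) +oo%E.

Definition Linfty_continuous_on (R : realType) (I : set R) (u : R -> R -> R) :
    Prop :=
  forall t, I t ->
    ('N[@lebesgue_measure R]_+oo [EFin \o (u s \- u t)%R])%E @[s --> t]
      --> 0%E.

(* u solves Burgers' equation for the times in the open set I and
   belongs to C^0(I, L^oo(R)). *)
Definition burgers_solution (R : realType) (I : set R) (u : R -> R -> R) :
    Prop :=
  [/\ C12_on I u,
      (forall t x, I t -> dt u t x + u t x * dx u t x = dx (dx u) t x),
      (forall t, I t -> Linfty (u t)) &
      Linfty_continuous_on I u].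

(* Weak-* convergence in L^oo(R), the dual of L^1(R), as t -> 0+. *)
Definition weak_star_cvg0 (R : realType) (u : R -> R -> R) (u0 : R -> R) :
    Prop :=
  forall g : R -> R, g \in Lfun (@lebesgue_measure R) 1%E ->
    \int[lebesgue_measure]_x (u t x * g x) @[t --> 0^'+]
      --> \int[lebesgue_measure]_x (u0 x * g x).

(* The graph of the flow: u t = S_t(u0) for t > 0. A function u with these
   properties is uniquely determined by u0 on t > 0; its values for t <= 0
   are irrelevant. *)
Definition burgers_flow (R : realType) (u0 : R -> R) (u : R -> R -> R) : Prop :=
  burgers_solution `]0, +oo[ u /\ weak_star_cvg0 u u0.

Definition omega0 (R : realType) (u0 : R -> R) : set (R -> R) :=
  [set v | Linfty v /\
     exists (u : R -> R -> R) (tk : nat -> R),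
       [/\ burgers_flow u0 u,
           tk k @[k --> \oo] --> +oo &
           forall a b : R, {uniform `[a, b], u (tk k) @[k --> \oo] --> v}]].

Definition entire_solution (R : realType) (v : R -> R -> R) : Prop :=
  burgers_solution setT v.

Definition tanh (R : realType) (y : R) : R :=
  (expR y - expR (- y)) / (expR y + expR (- y)).

(* The argument order (beta, alpha) lists the limit at -oo first. *)
Definition shock (R : realType) (beta alpha y : R) : R :=
  let c := (alpha + beta) / 2 in
  let delta := (beta - alpha) / 2 in
  c - delta * tanh (delta * y / 2).

Definition sup_norm (R : realType) (f : R -> R) : \bar R :=
  ereal_sup (range (fun x => `|f x|%:E)).

Definition shock_merger (R : realType) (v : R -> R -> R) : Prop :=
  exists alpha gamma beta x0 x1 x2 : R,
    [/\ alpha < gamma, gamma < beta,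
        sup_norm (fun x =>
          v t x - shock beta alpha (x - (alpha + beta) / 2 * t - x0))
          @[t --> +oo] --> 0%E &
        sup_norm (fun x =>
          v t x - shock beta gamma (x - (beta + gamma) / 2 * t - x1)
                - shock gamma alpha (x - (gamma + alpha) / 2 * t - x2) + gamma)
          @[t --> -oo] --> 0%E].

(* Main.v *)
Require Import Defs.
From HB Require Import structures.
From mathcomp Require Import all_boot all_order all_algebra.
From mathcomp Require Import all_classical all_reals all_analysis.
From mathcomp Require Import ess_sup_inf measurable_realfun ring lra.

(** Under the Cole-Hopf transform [u = - 2 p_x / p], positive solutions [p] of
    the heat equation give solutions of Burgers' equation. The merger is the
    image of [p = 1 + e^t (e^x + e^-x)]. Each of the three exponentials alone
    gives a constant state, namely 0, -2 and 2. For [t] very negative the term 1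
    dominates in the middle, and there are two shocks, which travel towards each
    other; for [t] large it is negligible, and what remains is the standing
    shock [- 2 tanh x].

    The initial datum is built so that this scenario is replayed near the
    origin at a sequence of times [T_k] tending to infinity. Let [p] be the heat
    flow of a positive measure. Seen at time [T + s] and position [x], a mass
    [e^T] at the point [2 T] contributes
<<
      e^T e^(- (x - 2 T)^2 / (4 (T + s)))  ~  e^(s + x)
>>
    and likewise [e^(s - x)] for a mass at [- 2 T], whereas the masses at
    distance much less than [sqrt T] from the origin contribute their total
    mass. So let the measure consist of masses at the points [2 T_k] and
    [- 2 T_k], those of index [k] being [e^(T_k)] times the total of the
    previous ones (up to a fixed factor), with [T_(k+1) = T_k ^ 3]. At time
    [T_k + s] all earlier masses act as one mass at the origin, the later ones
    are too far to be seen, and [p] is nearly proportional to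
    [1 + e^s (e^x + e^-x)], uniformly for [x] in a compact set; the same holds
    for [p_x]. Hence the solution of Burgers' equation at time [T_k + s] tends
    to the merger at time [s].

    Point masses are not admissible, since [u] must be bounded. Each of them is
    replaced by a cloud, with masses [e^(- 3 |n|)] at integer distances [n] from
    its centre, so that the measure has bounded logarithmic slope at scale 1. On
    such a measure every moment of the heat kernel is at most a constant times
    the zeroth one, uniformly in [x] ([moment_le]); this bounds [u] and its
    derivatives ([cole_hopf]), and gives continuity in the sup norm. Starting
    from the heat flow at time 1 makes the solution smooth up to the initial
    time, where weak-star convergence follows from uniform convergence.

    The regularity of the flow is in [superflow_burgers], the asymptotics at the
    successive stages in [super_stage] and [stage_estimate], and the properties
    of the limit in [merger_is_shock_merger] and [merger_not_shock]. *)

Set Implicit Arguments.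
Unset Strict Implicit.
Unset Printing Implicit Defensive.

Import Order.TTheory GRing.Theory Num.Theory.
Import numFieldNormedType.Exports.

Local Open Scope classical_set_scope.
Local Open Scope ring_scope.

(** * Differential calculus on the real line *)

Section Calculus.
Variable R : realType.
Implicit Types (f g df : R -> R) (x a b l M : R).

(** A plain proposition rather than an instance of the class [is_derive]:
    the rules below are then composed by unification alone. *)
Definition has_derive f x l : Prop := is_derive x 1 f l.

Lemma has_deriveD f g x a b : has_derive f x a -> has_derive g x b ->
  has_derive (fun y => f y + g y) x (a + b).
Proof. by move=> fa gb; exact: is_deriveD. Qed.

Lemma has_deriveB f g x a b : has_derive f x a -> has_derive g x b ->
  has_derive (fun y => f y - g y) x (a - b).
Proof. by move=> fa gb; exact: is_deriveB. Qed.

Lemma has_deriveN f x a : has_derive f x a -> has_derive (fun y => - f y) x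
  (- a).
Proof. by move=> fa; exact: is_deriveN. Qed.

Lemma has_deriveM f g x a b : has_derive f x a -> has_derive g x b ->
  has_derive (fun y => f y * g y) x (a * g x + f x * b).
Proof.
move=> fa gb; have h := @is_deriveM R R^o f g x 1 a b fa gb.
by apply: is_derive_eq h _; rewrite /GRing.scale/= addrC mulrC.
Qed.

Lemma has_deriveV f x a : f x != 0 -> has_derive f x a ->
  has_derive (fun y => (f y)^-1) x (- a / f x ^+ 2).
Proof.
move=> fx0 [df fa]; apply: DeriveDef; first exact: derivableV.
by rewrite deriveV// fa /GRing.scale/= mulNr mulNr mulrC.
Qed.

Lemma has_derive_comp f g x a b : has_derive f x a -> has_derive g (f x) b ->
  has_derive (fun y => g (f y)) x (a * b).
Proof.
move=> [df fa] [dg gb]; apply: DeriveDef.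
  apply/derivable1_diffP/differentiable_comp; exact/derivable1_diffP.
by rewrite -derive1E derive1_comp// !derive1E fa gb mulrC.
Qed.

Lemma has_derive_expR f x a : has_derive f x a ->
  has_derive (fun y => expR (f y)) x (a * expR (f x)).
Proof. by move=> fa; apply: has_derive_comp => //; exact: is_derive_expR. Qed.

Lemma has_deriveX f x a n : has_derive f x a ->
  has_derive (fun y => f y ^+ n) x (n%:R * f x ^+ n.-1 * a).
Proof.
move=> fa; rewrite mulrC.
apply: (@has_derive_comp f (fun y => y ^+ n)) => //; apply: DeriveDef.
  exact: exprn_derivable.
by rewrite exp_derive /GRing.scale/= mulr1.
Qed.

Lemma has_derive_id x : has_derive (fun y => y) x 1.
Proof. exact: is_derive_id. Qed.

Lemma has_derive_cst x a : has_derive (fun=> a) x 0.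
Proof. exact: is_derive_cst. Qed.

Lemma has_derive_eq f x a b : has_derive f x a -> a = b -> has_derive f x b.
Proof. by move=> fa <-. Qed.

Lemma has_derive_continuous f x a : has_derive f x a -> {for x, continuous f}.
Proof. by move=> [df _]; exact/differentiable_continuous/derivable1_diffP. Qed.

(** The hypotheses are on the ball of centre [a] through [b], which avoids
    distinguishing [a < b] from [b < a] in the applications. *)
Lemma mvt_le f df a b M :
  (forall z, `|z - a| <= `|b - a| -> has_derive f z (df z)) ->
  (forall z, `|z - a| <= `|b - a| -> `|df z| <= M) ->
  `|f b - f a| <= M * `|b - a|.
Proof.
move=> fdf dfM.
have [ab|ba|->] := ltgtP a b; last by rewrite !subrr normr0 mulr0.
- have [||c cab ->] := @MVT R f df a b ab.
  + move=> x; rewrite in_itv/= => /andP[ax xb]; apply: fdf.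
    by rewrite !ger0_norm ?subr_ge0 ?(ltW ax) ?(ltW ab)// lerD2r ltW.
  + apply: continuous_in_subspaceT => x; rewrite inE/= in_itv/= => /andP[ax xb].
    apply: has_derive_continuous; apply: fdf.
    by rewrite !ger0_norm ?subr_ge0 ?(ltW ab)// lerD2r.
  rewrite normrM ler_wpM2r//; apply: dfM.
  move: cab; rewrite in_itv/= => /andP[ac cb].
  by rewrite !ger0_norm ?subr_ge0 ?(ltW ac) ?(ltW ab)// lerD2r ltW.
- have [||c cab E] := @MVT R f df b a ba.
  + move=> x; rewrite in_itv/= => /andP[ax xb]; apply: fdf.
    by rewrite !ler0_norm ?subr_le0 ?(ltW xb) ?(ltW ba)// lerN2 lerD2r ltW.
  + apply: continuous_in_subspaceT => x; rewrite inE/= in_itv/= => /andP[ax xb].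
    apply: has_derive_continuous; apply: fdf.
    by rewrite !ler0_norm ?subr_le0 ?(ltW ba)// lerN2 lerD2r.
  rewrite distrC E normrM (distrC a) ler_wpM2r//; apply: dfM.
  move: cab; rewrite in_itv/= => /andP[ac cb].
  by rewrite !ler0_norm ?subr_le0 ?(ltW cb) ?(ltW ba)// lerN2 lerD2r ltW.
Qed.

(** The mean value inequality is applied to [f z - z * f1 a], whose derivative
    [f1 z - f1 a] is controlled by the mean value inequality for [f1]. *)
Lemma taylor_le f f1 f2 a b M :
  (forall z, `|z - a| <= `|b - a| -> has_derive f z (f1 z)) ->
  (forall z, `|z - a| <= `|b - a| -> has_derive f1 z (f2 z)) ->
  (forall z, `|z - a| <= `|b - a| -> `|f2 z| <= M) ->
  `|f b - f a - (b - a) * f1 a| <= M * `|b - a| ^+ 2.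
Proof.
move=> d1 d2 f2M.
have M0 : 0 <= M.
  by apply: (le_trans (normr_ge0 (f2 a))); apply: f2M; rewrite subrr normr0.
have /mvt_le H : forall z, `|z - a| <= `|b - a| ->
    has_derive (fun z => f z - z * f1 a) z (f1 z - f1 a).
  move=> z za; apply: has_derive_eq.
    exact: (has_deriveB (d1 _ za)
      (has_deriveM (has_derive_id z) (has_derive_cst z (f1 a)))).
  by rewrite mul1r mulr0 addr0.
have -> : f b - f a - (b - a) * f1 a = f b - b * f1 a - (f a - a * f1 a) by
  ring.
rewrite expr2 mulrA; apply: H => z za.
apply: (@le_trans _ _ (M * `|z - a|)); last by rewrite ler_wpM2l.
by apply: (@mvt_le f1 f2) => w wz; [apply: d2|apply: f2M]; exact: le_trans wz
  za.
Qed.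

(** Derivatives of series are obtained in this form: a quadratic bound on the
    Taylor remainder survives summation term by term. *)
Lemma has_derive_quadratic f a l d M : 0 < d ->
  (forall h, `|h| <= d -> `|f (a + h) - f a - h * l| <= M * h ^+ 2) ->
  has_derive f a l.
Proof.
move=> d0 H.
have M0 : 0 <= M.
  have := H d; rewrite gtr0_norm// => /(_ (lexx _)) /(le_trans (normr_ge0 _)).
  by rewrite pmulr_lge0// exprn_gt0.
have L : h^-1 *: (f (h *: (1 : R) + a) - f a) @[h --> 0^'] --> l.
  apply/cvgrPdist_le => e e0.
  have eM : 0 < (M + 1)^-1 * e by rewrite mulr_gt0// invr_gt0; lra.
  near=> h.
  have h0 : h != 0 by near: h; exact: nbhs_dnbhs_neq.
  have -> : l - h^-1 *: (f (h *: (1 : R) + a) - f a) =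
      - (h^-1 * (f (a + h) - f a - h * l)).
    by rewrite /GRing.scale/= mulr1 (addrC h); field.
  rewrite normrN normrM normfV ler_pdivrMl ?normr_gt0//.
  apply: (le_trans (H h _)).
    near: h; apply: dnbhs0_le; exact: d0.
  rewrite -[h ^+ 2]real_normK ?num_real// expr2 mulrCA ler_wpM2l//.
  apply: (@le_trans _ _ ((M + 1) * `|h|)); first by rewrite ler_wpM2r//; lra.
  rewrite -ler_pdivlMl; last by lra.
  near: h; apply: dnbhs0_le; exact: eM.
apply: DeriveDef; first by apply/cvg_ex; exists l.
by rewrite /derive; exact: cvg_lim L.
Unshelve. all: by end_near. Qed.

End Calculus.

(** * The Cole-Hopf transform *)

Section Sup.
Variable R : realType.
Implicit Types (f : R -> R).

Lemma Lnorm_oo_le f (C : R) : (forall x, `|f x| <= C) ->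
  ('N[@lebesgue_measure R]_+oo [EFin \o f] <= C%:E)%E.
Proof.
move=> fC; rewrite unlock; case: ifPn => _.
  by apply/ess_supP/nearW => x /=; rewrite lee_fin.
by rewrite lee_fin (le_trans (normr_ge0 (f 0))).
Qed.

Lemma bounded_Linfty f (C : R) : measurable_fun setT f ->
  (forall x, `|f x| <= C) -> Linfty f.
Proof.
move=> mf fC; rewrite /Linfty inE/=; apply/andP; split; rewrite inE//=.
by rewrite /finite_norm (le_lt_trans (Lnorm_oo_le fC))// ltry.
Qed.

Lemma near_continuous (T U : topologicalType) (f g : T -> U) (p : T) :
  (\forall q \near p, f q = g q) -> {for p, continuous g} ->
  {for p, continuous f}.
Proof.
move=> fg cg; rewrite /prop_for /continuous_at (nbhs_singleton fg).
apply: cvg_trans cg; apply: near_eq_cvg; near=> q.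
by apply/esym; near: q.
Unshelve. all: by end_near. Qed.

Lemma near_fst (I : set R) (t x : R) : open I -> I t ->
  \forall q \near (t, x), I q.1.
Proof.
move=> oI It; have : \forall s \near t, I s by exact: open_nbhs_nbhs.
by move=> /(@cvg_fst _ _ (nbhs t) (nbhs x) _).
Qed.

End Sup.

Section ContinuousAt.
Variables (R : realType) (T : topologicalType) (p : T).
Implicit Types f g : T -> R.

Lemma continuous_forM f g : {for p, continuous f} -> {for p, continuous g} ->
  {for p, continuous (fun z => f z * g z)}.
Proof. by move=> cf cg; exact: cvgM. Qed.

Lemma continuous_forD f g : {for p, continuous f} -> {for p, continuous g} ->
  {for p, continuous (fun z => f z + g z)}.
Proof. by move=> cf cg; exact: cvgD. Qed.

Lemma continuous_forB f g : {for p, continuous f} -> {for p, continuous g} ->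
  {for p, continuous (fun z => f z - g z)}.
Proof. by move=> cf cg; exact: cvgB. Qed.

Lemma continuous_for_cst (k : R) : {for p, continuous (fun=> k : R)}.
Proof. exact: cvg_cst. Qed.

Lemma continuous_forX f n : {for p, continuous f} ->
  {for p, continuous (fun z => f z ^+ n)}.
Proof.
move=> cf; elim: n => [|n ih]; first exact: continuous_for_cst.
have -> : (fun z => f z ^+ n.+1) = (fun z => f z * f z ^+ n).
  by apply/funext => z; rewrite exprS.
exact: continuous_forM.
Qed.

Lemma continuous_forV f : f p != 0 -> {for p, continuous f} ->
  {for p, continuous (fun z => (f z)^-1)}.
Proof. by move=> fp0 cf; exact: cvgV. Qed.

End ContinuousAt.


(** Both bounds are uniform in [x], which makes this a local Lipschitz
    condition for the sup norm. *)
Definition lipschitz_in_time (R : realType) (I : set R) (u : R -> R -> R) :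
    Prop :=
  forall t, I t -> exists C d : R, 0 < d /\ forall s x, `|s - t| <= d ->
    `|u s x| <= C /\ `|u s x - u t x| <= C * `|s - t|.

Section ColeHopf.
Variable R : realType.
Variables (I : set R) (p0 p1 p2 p3 : R -> R -> R) (c : R -> R).
Hypothesis oI : open I.
Hypothesis p0_gt0 : forall t x, I t -> 0 < p0 t x.
Hypothesis p0x : forall t x, I t -> has_derive (p0 t) x (p1 t x).
Hypothesis p1x : forall t x, I t -> has_derive (p1 t) x (p2 t x).
Hypothesis p2x : forall t x, I t -> has_derive (p2 t) x (p3 t x).
Hypothesis p0t : forall t x, I t ->
  has_derive (p0 ^~ x) t (p2 t x + c t * p0 t x).
Hypothesis p1t : forall t x, I t ->
  has_derive (p1 ^~ x) t (p3 t x + c t * p1 t x).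
Hypothesis p_cont : forall t x, I t ->
  [/\ {for (t, x), continuous (fun z : R * R => p0 z.1 z.2)},
      {for (t, x), continuous (fun z : R * R => p1 z.1 z.2)},
      {for (t, x), continuous (fun z : R * R => p2 z.1 z.2)} &
      {for (t, x), continuous (fun z : R * R => p3 z.1 z.2)}].
Hypothesis p_bnd : forall t, I t -> exists C d : R, 0 < d /\
  forall s x, `|s - t| <= d ->
    I s /\ [/\ `|p1 s x| <= C * p0 s x, `|p2 s x| <= C * p0 s x
             & `|p3 s x| <= C * p0 s x].

Let u (t x : R) : R := - 2 * p1 t x * (p0 t x)^-1.
Let ut (t x : R) : R := - 2 *
  (p3 t x * (p0 t x)^-1 - p1 t x * p2 t x * (p0 t x)^-1 ^+ 2).
Let ux (t x : R) : R := - 2 *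
  (p2 t x * (p0 t x)^-1 - p1 t x ^+ 2 * (p0 t x)^-1 ^+ 2).
Let uxx (t x : R) : R := - 2 *
  (p3 t x * (p0 t x)^-1 - 3 * p1 t x * p2 t x * (p0 t x)^-1 ^+ 2
                      + 2 * p1 t x ^+ 3 * (p0 t x)^-1 ^+ 3).

Let hut t x : I t -> has_derive (u ^~ x) t (ut t x).
Proof.
move=> It; have p00 : p0 t x != 0 by rewrite gt_eqF ?p0_gt0.
apply: has_derive_eq.
  apply: (has_deriveM (has_deriveM (has_derive_cst _ _) (p1t x It))
    (has_deriveV _ (p0t x It))) => //.
by rewrite /ut; field.
Qed.

Let hux t x : I t -> has_derive (u t) x (ux t x).
Proof.
move=> It; have p00 : p0 t x != 0 by rewrite gt_eqF ?p0_gt0.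
apply: has_derive_eq.
  apply: (has_deriveM (has_deriveM (has_derive_cst _ _) (p1x x It))
    (has_deriveV _ (p0x x It))) => //.
by rewrite /ux; field.
Qed.

Let huxx t x : I t -> has_derive (ux t) x (uxx t x).
Proof.
move=> It; have p00 : p0 t x != 0 by rewrite gt_eqF ?p0_gt0.
have dV := has_deriveV p00 (p0x x It).
apply: has_derive_eq.
  apply: (has_deriveM (has_derive_cst _ _)
    (has_deriveB (has_deriveM (p2x x It) dV)
     (has_deriveM (has_deriveX 2 (p1x x It)) (has_deriveX 2 dV)))).
by rewrite /uxx/=; field.
Qed.

Let dtE t x : I t -> dt u t x = ut t x.
Proof. by move=> It; rewrite /dt derive1E; case: (hut x It). Qed.

Let dxE t : I t -> dx u t = ux t.
Proof.
by move=> It; apply/funext => x; rewrite /dx derive1E; case: (hux x It).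
Qed.

Let dxxE t x : I t -> dx (dx u) t x = uxx t x.
Proof.
by move=> It; rewrite {1}/dx dxE// derive1E; case: (huxx x It).
Qed.

Let cV t x : I t -> {for (t, x), continuous (fun z : R * R => (p0 z.1 z.2)^-1)}.
Proof.
move=> It; have [c0 _ _ _] := p_cont x It; apply: continuous_forV => //=.
by rewrite gt_eqF ?p0_gt0.
Qed.

Let u_C12 : C12_on I u.
Proof.
move=> t x It; split.
  rewrite (dxE It).
  by split; [case: (hut x It)|case: (hux x It)|case: (huxx x It)].
have [c0 c1 c2 c3] := p_cont x It; have cV0 := @cV t x It.
have near_I := @near_fst _ _ _ x oI It.
split.
- refine (continuous_forM (continuous_forM _ c1) cV0); exact:
  continuous_for_cst.
- apply: (@near_continuous _ _ _ (fun z : R * R => ut z.1 z.2)).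
    by near=> z; apply: dtE; near: z.
  refine (continuous_forM _ (continuous_forB (continuous_forM c3 cV0)
    (continuous_forM (continuous_forM c1 c2) (continuous_forX (n:=2) cV0)))).
  exact: continuous_for_cst.
- apply: (@near_continuous _ _ _ (fun z : R * R => ux z.1 z.2)).
    by near=> z; rewrite dxE; [|near: z].
  refine (continuous_forM _ (continuous_forB (continuous_forM c2 cV0)
    (continuous_forM (continuous_forX (n:=2) c1)
      (continuous_forX (n:=2) cV0)))).
  exact: continuous_for_cst.
- apply: (@near_continuous _ _ _ (fun z : R * R => uxx z.1 z.2)).
    by near=> z; rewrite dxxE; [|near: z].
  have c12 := continuous_forM
    (continuous_forM (@continuous_for_cst R _ (t, x) 3) c1) c2.
  have c111 := continuous_forM (@continuous_for_cst R _ (t, x) 2)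
    (continuous_forX (n:=3) c1).
  refine (continuous_forM _ (continuous_forD
    (continuous_forB (continuous_forM c3 cV0)
      (continuous_forM c12 (continuous_forX (n:=2) cV0)))
    (continuous_forM c111 (continuous_forX (n:=3) cV0)))).
  exact: continuous_for_cst.
Unshelve. all: by end_near. Qed.

Lemma cole_hopf_lipschitz t : I t -> exists C d : R, 0 < d /\
  forall s x, `|s - t| <= d ->
    `|u s x| <= C /\ `|u s x - u t x| <= C * `|s - t|.
Proof.
move=> It; have [C [d [d0 H]]] := p_bnd It.
have rat s x : `|s - t| <= d -> [/\ 0 <= C, `|p1 s x * (p0 s x)^-1| <= C,
    `|p2 s x * (p0 s x)^-1| <= C & `|p3 s x * (p0 s x)^-1| <= C].
  move=> st; have [Is [h1 h2 h3]] := H s x st; have p00 := p0_gt0 x Is.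
  rewrite !normrM !normfV !(gtr0_norm p00) !ler_pdivrMr//; split => //.
  by rewrite -(pmulr_lge0 _ p00) (le_trans _ h1).
exists (2 * C + 2 * C ^+ 2), d; split => // s x st.
have [C0 h1 h2 h3] := rat s x st.
split.
  rewrite /u -mulrA normrM normrN (ger0_norm (ler0n _ 2)).
  have := sqr_ge0 C; lra.
apply: (@mvt_le _ (u ^~ x) (ut ^~ x)) => z zt.
  by apply: hut; have [] := H z x (le_trans zt st).
have [_ g1 g2 g3] := rat z x (le_trans zt st).
rewrite /ut; set a1 := p1 z x * _ in g1; set a2 := p2 z x * _ in g2.
have -> : p1 z x * p2 z x * (p0 z x)^-1 ^+ 2 = a1 * a2.
  by rewrite /a1 /a2; ring.
rewrite normrM normrN (ger0_norm (ler0n _ 2)) -mulrDr ler_wpM2l//.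
apply: (le_trans (ler_normB _ _)); rewrite lerD// normrM expr2.
by apply: ler_pM.
Qed.

Lemma cole_hopf_burgers : burgers_solution I u.
Proof.
split => //.
- by move=> t x It; rewrite dtE// dxxE// dxE// /ut /ux /uxx /u; field;
     rewrite gt_eqF ?p0_gt0.
- move=> t It; have [C [d [d0 H]]] := cole_hopf_lipschitz It.
  apply: (@bounded_Linfty _ _ C).
    apply: continuous_measurable_fun => x.
    by apply: has_derive_continuous; exact: hux.
  by move=> x; have [|//] := H t x; rewrite subrr normr0 ltW.
- move=> t It; have [C [d [d0 H]]] := cole_hopf_lipschitz It.
  apply: (@squeeze_cvge _ _ _ _ (cst 0%E) _ (fun s => (C * `|s - t|)%:E)).
  + near=> s; rewrite Lnorm_ge0/=.
    apply: Lnorm_oo_le => x; have [|//] := H s x.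
    near: s; apply/nbhs_ballP; exists d => //= s.
    by rewrite /ball/= distrC => /ltW.
  + exact: cvg_cst.
  + apply: cvg_EFin; first exact: nearW.
    have hc : {for t, continuous (fun s => C * `|s - t|)}.
      apply: (@continuous_forM R R t (fun=> C) (fun s => `|s - t|)).
        exact: continuous_for_cst.
      apply: cvg_norm; apply: (@continuous_forB R R t (fun s => s) (fun=> t)).
        exact: cvg_id.
      exact: continuous_for_cst.
    by move: hc; rewrite /prop_for /continuous_at subrr normr0 mulr0.
Unshelve. all: by end_near. Qed.

(** The quotient [- 2 * p1 / p0] only needs the heat equation up to a term
    [c t * p0]: this term is cancelled by the one it induces on [p1], so that
    Gaussians need not be normalized. Bounding the [p_i] by [p0] bounds [u] and
    its time derivative uniformly in [x], whence the continuity in sup norm. *)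
Lemma cole_hopf : burgers_solution I u /\ lipschitz_in_time I u.
Proof.
by split; [exact: cole_hopf_burgers|move=> t It; exact: cole_hopf_lipschitz].
Qed.

End ColeHopf.

(** * Absolutely convergent series *)

Section Series.
Variable R : realType.
Implicit Types (u v : nat -> R) (k : R).

Definition tsum u : R := limn (series u).

Definition abs_summable u : Prop := cvgn (series (fun n => `|u n|)).

Lemma abs_summable_cvg u : abs_summable u -> cvgn (series u).
Proof. exact: normed_cvg. Qed.

Lemma abs_summable_le u v : (forall n, `|u n| <= v n) -> abs_summable v ->
  abs_summable u.
Proof.
move=> uv sv; apply: series_le_cvg sv => // n.
by rewrite (le_trans (uv n))// ler_norm.
Qed.

Lemma abs_summableD u v : abs_summable u -> abs_summable v ->
  abs_summable (fun n => u n + v n).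
Proof.
move=> su sv; apply: (@abs_summable_le _ (fun n => `|u n| + `|v n|)).
  by move=> n; exact: ler_normD.
rewrite /abs_summable; under eq_fun do rewrite ger0_norm ?addr_ge0//.
by have := is_cvg_seriesD su sv.
Qed.

Lemma abs_summableZ k u : abs_summable u -> abs_summable (fun n => k * u n).
Proof.
move=> su; rewrite /abs_summable; under eq_fun do rewrite normrM.
by have := @is_cvg_seriesZ R (fun n => `|u n|) `|k| su.
Qed.

Lemma tsumD u v : abs_summable u -> abs_summable v ->
  tsum (fun n => u n + v n) = tsum u + tsum v.
Proof.
by move=> /abs_summable_cvg su /abs_summable_cvg sv; have := lim_seriesD su sv.
Qed.

Lemma tsumZ k u : abs_summable u -> tsum (fun n => k * u n) = k * tsum u.
Proof. by move=> /abs_summable_cvg su; have := @lim_seriesZ R u k su. Qed.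

Lemma tsumB u v : abs_summable u -> abs_summable v ->
  tsum (fun n => u n - v n) = tsum u - tsum v.
Proof.
by move=> /abs_summable_cvg su /abs_summable_cvg sv; have := lim_seriesB su sv.
Qed.

Lemma le_tsum u v : abs_summable u -> abs_summable v -> (forall n, u n <= v n)
  ->
  tsum u <= tsum v.
Proof.
move=> /abs_summable_cvg su /abs_summable_cvg sv uv; exact: lim_series_le.
Qed.

Lemma norm_tsum_le u v : (forall n, `|u n| <= v n) -> abs_summable v ->
  `|tsum u| <= tsum v.
Proof.
move=> uv sv; have su := abs_summable_le uv sv.
apply: (le_trans (lim_series_norm su)); apply: lim_series_le => //.
exact: abs_summable_cvg.
Qed.

Lemma tsum_fin u m : tsum (fun n => if (n < m)%N then u n else 0) =
  \sum_(0 <= n < m) u n.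
Proof.
apply: lim_near_cst => //; exists m => // i /= mi.
rewrite /series/= (@big_cat_nat _ _ _ m 0 i)//= [X in _ + X]big1_seq ?addr0.
  by rewrite !big_nat; apply: eq_bigr => n /= ->.
by move=> n; rewrite mem_index_iota => /andP[_ /andP[mn _]]; rewrite ltnNge mn.
Qed.

Lemma tsum_split u m : abs_summable u -> tsum u =
  \sum_(0 <= n < m) u n + tsum (fun n => if (n < m)%N then 0 else u n).
Proof.
move=> su; rewrite -tsum_fin -tsumD.
- by congr tsum; apply/funext => n; case: ifP; rewrite ?addr0 ?add0r.
- apply: (@abs_summable_le _ (fun n => `|u n|)).
    by move=> n; case: ifP; rewrite ?normr0.
  by rewrite /abs_summable; under eq_fun do rewrite normr_id.
- apply: (@abs_summable_le _ (fun n => `|u n|)).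
    by move=> n; case: ifP; rewrite ?normr0.
  by rewrite /abs_summable; under eq_fun do rewrite normr_id.
Qed.

Lemma tsum_ge0 u : (forall n, 0 <= u n) -> abs_summable u -> 0 <= tsum u.
Proof.
move=> u0 su; apply: (le_trans (normr_ge0 (tsum u))).
by apply: norm_tsum_le su => n; rewrite ger0_norm.
Qed.

Lemma tsum_ge_term u m : (forall n, 0 <= u n) -> abs_summable u -> u m <= tsum
  u.
Proof.
move=> u0 su; rewrite (tsum_split m.+1 su) big_nat_recr//= addrAC lerDr.
apply: addr_ge0; first exact: sumr_ge0.
apply: tsum_ge0 => [n|]; first by case: ifP.
apply: abs_summable_le su => n; case: ifP => _; rewrite ?normr0// ger0_norm//.
Qed.

Lemma abs_summable_expN : abs_summable (fun n => expR (- n%:R)).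
Proof.
rewrite /abs_summable; have -> : (fun n => `|expR (- n%:R) : R|) =
    geometric 1 (expR (-1)).
  apply/funext => n; rewrite /geometric/= mul1r -expRM_natl mulrN1.
  by rewrite ger0_norm ?expR_ge0.
apply: is_cvg_geometric_series; by rewrite ger0_norm ?expR_ge0 ?expR_lt1.
Qed.

Definition geometric_mass := tsum (fun n => expR (- n%:R)).

Lemma geometric_mass_gt0 : 0 < geometric_mass.
Proof.
apply: (lt_le_trans _ (tsum_ge_term 0 _ abs_summable_expN)) => [|n].
  by rewrite expR_gt0.
exact: expR_ge0.
Qed.

End Series.

(** * Clouds of point masses and their superpositions *)

Section Cloud.
Variable R : realType.
Implicit Types (f g : R -> R) (c k : R).

(** The cloud of centre [c] is the measure with mass [exp (- 3 n)] at [c + n]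
    and at [c - n] for each [n] (the centre is counted twice), and [cloud f c]
    is the integral of [f] against it. The rate 3 lets it integrate functions
    that grow like [exp (2 |y|)]. *)
Definition cloud_term f c n := expR (- (3 * n%:R)) *
  (f (c + n%:R) + f (c - n%:R)).

Definition cloud f c := tsum (cloud_term f c).

Definition tame_at f c (B : R) : Prop :=
  forall n : nat, `|f (c + n%:R)| <= B * expR (2 * n%:R) /\
                  `|f (c - n%:R)| <= B * expR (2 * n%:R).

Definition tame f c : Prop := exists B, tame_at f c B.

Lemma cloud_term_le f c B n : tame_at f c B ->
  `|cloud_term f c n| <= (2 * B) * expR (- n%:R).
Proof.
move=> /(_ n)[h1 h2]; rewrite normrM ger0_norm ?expR_ge0//.
have -> : 2 * B * expR (- n%:R) = expR (- (3 * n%:R)) *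
    (B * expR (2 * n%:R) + B * expR (2 * n%:R)).
  have -> : - n%:R = - (3 * n%:R) + 2 * n%:R :> R by ring.
  by rewrite expRD; ring.
rewrite ler_wpM2l ?expR_ge0//; apply: (le_trans (ler_normD _ _)).
exact: lerD.
Qed.

Lemma summable_cloud f c : tame f c -> abs_summable (cloud_term f c).
Proof.
move=> [B fB]; apply: (@abs_summable_le _ _ (fun n => (2 * B) * expR (- n%:R))).
  by move=> n; exact: cloud_term_le.
exact/abs_summableZ/abs_summable_expN.
Qed.

Lemma cloud_norm_bound f c B : tame_at f c B -> `|cloud f c| <= 2 *
  geometric_mass R * B.
Proof.
move=> fB; have := @norm_tsum_le _ (cloud_term f c)
  (fun n => (2 * B) * expR (- n%:R)).
rewrite tsumZ; last exact: abs_summable_expN.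
rewrite mulrAC; apply => [n|]; first exact: cloud_term_le.
exact/abs_summableZ/abs_summable_expN.
Qed.

Lemma tameD f g c : tame f c -> tame g c -> tame (fun y => f y + g y) c.
Proof.
move=> [B fB] [C gC]; exists (B + C) => n.
have [f1 f2] := fB n; have [g1 g2] := gC n.
by rewrite mulrDl; split; apply: (le_trans (ler_normD _ _)); exact: lerD.
Qed.

Lemma tameZ f c k : tame f c -> tame (fun y => k * f y) c.
Proof.
move=> [B fB]; exists (`|k| * B) => n; have [f1 f2] := fB n.
by rewrite -mulrA !normrM; split; apply: ler_wpM2l.
Qed.

Lemma cloudD f g c : tame f c -> tame g c ->
  cloud (fun y => f y + g y) c = cloud f c + cloud g c.
Proof.
move=> hf hg; rewrite /cloud -tsumD; [|exact: summable_cloud..].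
by congr tsum; apply/funext => n; rewrite /cloud_term; ring.
Qed.

Lemma cloudZ f c k : tame f c -> cloud (fun y => k * f y) c = k * cloud f c.
Proof.
move=> hf; rewrite /cloud -tsumZ; last exact: summable_cloud.
by congr tsum; apply/funext => n; rewrite /cloud_term; ring.
Qed.

Lemma cloudB f g c : tame f c -> tame g c ->
  cloud (fun y => f y - g y) c = cloud f c - cloud g c.
Proof.
move=> hf hg; rewrite /cloud -tsumB; [|exact: summable_cloud..].
by congr tsum; apply/funext => n; rewrite /cloud_term; ring.
Qed.

Lemma cloud_norm_le f g c : tame g c -> (forall y, `|f y| <= g y) ->
  `|cloud f c| <= cloud g c.
Proof.
move=> hg fg; apply: norm_tsum_le => [n|]; last exact: summable_cloud.
rewrite normrM ger0_norm ?expR_ge0// ler_wpM2l ?expR_ge0//.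
by apply: (le_trans (ler_normD _ _)); exact: lerD.
Qed.

Lemma cloud_ge_term f c n : tame f c -> (forall y, 0 <= f y) ->
  cloud_term f c n <= cloud f c.
Proof.
move=> hf f0; apply: (@tsum_ge_term _ (cloud_term f c)) => [m|].
  by rewrite mulr_ge0 ?expR_ge0// addr_ge0.
exact: summable_cloud.
Qed.

End Cloud.

Section Superposition.
Variables (R : realType) (a N : nat -> R).
Hypothesis a_ge0 : forall k, 0 <= a k.
Hypothesis N_ge0 : forall k, 0 <= N k.
Hypothesis sum_aN : abs_summable (fun k => a k * expR (- (2 * N k))).
Implicit Types (f g : R -> R).

(** [superpose f] is the integral of [f] against the sum over [k] of [a k] times
    the clouds of centres [N k] and [- N k]. *)
Definition superpose_term f k := a k * (cloud f (N k) + cloud f (- N k)).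

Definition superpose f := tsum (superpose_term f).

Definition rapid_by f B : Prop := forall y, `|f y| <= B * expR (- (2 * `|y|)).

Definition rapid f : Prop := exists B, rapid_by f B.

Lemma rapid_by_ge0 f B : rapid_by f B -> 0 <= B.
Proof.
move=> /(_ 0) /(le_trans (normr_ge0 _)).
by rewrite normr0 mulr0 oppr0 expR0 mulr1.
Qed.

Lemma rapid_tame_at f c B : rapid_by f B ->
  tame_at f c (B * expR (- (2 * `|c|))).
Proof.
move=> fB; have B0 := rapid_by_ge0 fB.
move=> n; rewrite -mulrA -expRD.
have nn : `|n%:R| = n%:R :> R by rewrite ger0_norm.
split; apply: (le_trans (fB _)); rewrite ler_wpM2l// ler_expR.
- have := ler_normB (c + n%:R) n%:R; rewrite addrK nn; lra.
- have := ler_normD (c - n%:R) n%:R; rewrite subrK nn; lra.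
Qed.

Lemma rapid_tame f c : rapid f -> tame f c.
Proof. by move=> [B /rapid_tame_at fB]; eexists; exact: fB. Qed.

Lemma rapidZ f k : rapid f -> rapid (fun y => k * f y).
Proof.
move=> [B fB]; exists (`|k| * B) => y.
by rewrite -mulrA normrM ler_wpM2l.
Qed.

Lemma rapidB f g : rapid f -> rapid g -> rapid (fun y => f y - g y).
Proof.
move=> [B fB] [C gC]; exists (B + C) => y.
by rewrite mulrDl; apply: (le_trans (ler_normB _ _)); exact: lerD.
Qed.

Lemma super_term_le f B k : rapid_by f B ->
  `|superpose_term f k| <= 4 * geometric_mass R * B *
    (a k * expR (- (2 * N k))).
Proof.
move=> fB; rewrite normrM ger0_norm//.
have h c : `|c| = N k -> `|cloud f c| <= 2 * geometric_mass R *
  (B * expR (- (2 * N k))).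
  by move=> <-; apply/cloud_norm_bound/rapid_tame_at.
have h1 : `|cloud f (N k)| <= 2 * geometric_mass R * (B * expR (- (2 * N k))).
  by apply: h; rewrite ger0_norm.
have h2 : `|cloud f (- N k)| <= 2 * geometric_mass R * (B * expR (- (2 * N k))).
  by apply: h; rewrite normrN ger0_norm.
have -> : 4 * geometric_mass R * B * (a k * expR (- (2 * N k))) =
   a k * (2 * geometric_mass R * (B * expR (- (2 * N k))) +
          2 * geometric_mass R * (B * expR (- (2 * N k)))) by ring.
by rewrite ler_wpM2l//; apply: (le_trans (ler_normD _ _)); exact: lerD.
Qed.

Lemma summable_super f : rapid f -> abs_summable (superpose_term f).
Proof.
move=> [B fB]; apply: (@abs_summable_le _ _
  (fun k => 4 * geometric_mass R * B * (a k * expR (- (2 * N k))))).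
  by move=> k; exact: super_term_le.
exact: abs_summableZ.
Qed.

Lemma super_norm_bound f B : rapid_by f B -> `|superpose f| <=
  4 * geometric_mass R * tsum (fun k => a k * expR (- (2 * N k))) * B.
Proof.
move=> fB; rewrite mulrAC -tsumZ//; apply: norm_tsum_le; last exact:
  abs_summableZ.
by move=> k; exact: super_term_le.
Qed.

Lemma superB f g : rapid f -> rapid g ->
  superpose (fun y => f y - g y) = superpose f - superpose g.
Proof.
move=> hf hg; rewrite /superpose -tsumB; [|exact: summable_super..].
congr tsum; apply/funext => k; rewrite /superpose_term.
by rewrite !cloudB; [ring|exact: rapid_tame..].
Qed.

Lemma superZ f r : rapid f -> superpose (fun y => r * f y) = r * superpose f.
Proof.
move=> hf; rewrite /superpose -tsumZ; last exact: summable_super.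
congr tsum; apply/funext => k; rewrite /superpose_term.
by rewrite !cloudZ; [ring|exact: rapid_tame..].
Qed.

Lemma super_norm_le f g : rapid g -> (forall y, `|f y| <= g y) ->
  `|superpose f| <= superpose g.
Proof.
move=> hg fg; apply: norm_tsum_le => [k|]; last exact: summable_super.
rewrite normrM ger0_norm// ler_wpM2l//.
apply: (le_trans (ler_normD _ _)).
by apply: lerD; apply: cloud_norm_le => //; exact: rapid_tame.
Qed.

(** Estimates that hold for one cloud, wherever its centre is, pass to every
    superposition with the same constant. *)
Lemma super_le_clouds f g C : rapid f -> rapid g ->
  (forall c, cloud f c <= C * cloud g c) -> superpose f <= C * superpose g.
Proof.
move=> hf hg fg; rewrite -tsumZ; last exact: summable_super.
apply: le_tsum; [exact: summable_super|exact/abs_summableZ/summable_super|].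
move=> k; rewrite /superpose_term mulrCA ler_wpM2l// mulrDr.
exact: lerD.
Qed.

Lemma super_gt0 f : 0 < a 0 -> rapid f -> (forall y, 0 < f y) -> 0 < superpose
  f.
Proof.
move=> a0 hf f0; have f0' y : 0 <= f y by exact: ltW.
have cl0 c : 0 < cloud f c.
  apply: (@lt_le_trans _ _ (cloud_term f c 0)).
    by rewrite mulr_gt0 ?expR_gt0// addr_gt0.
  by apply: cloud_ge_term => //; exact: rapid_tame.
apply: (@lt_le_trans _ _ (superpose_term f 0)).
  by rewrite mulr_gt0// addr_gt0.
apply: (@tsum_ge_term _ (superpose_term f) 0) => [k|]; last exact:
  summable_super.
by rewrite mulr_ge0// addr_ge0// ltW.
Qed.

(** Differentiation under the sum: the Taylor remainder of [F s y] at [s0] is at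
    most [B * exp (- 2 |y|)] times the square of the increment, and this bound
    can be integrated. *)
Lemma super_derive (F F1 F2 : R -> R -> R) (s0 d B : R) : 0 < d ->
  (forall s, `|s - s0| <= d -> rapid (F s)) -> rapid (F1 s0) ->
  (forall s y, `|s - s0| <= d -> has_derive (F ^~ y) s (F1 s y)) ->
  (forall s y, `|s - s0| <= d -> has_derive (F1 ^~ y) s (F2 s y)) ->
  (forall s, `|s - s0| <= d -> rapid_by (F2 s) B) ->
  has_derive (fun s => superpose (F s)) s0 (superpose (F1 s0)).
Proof.
move=> d0 rF rF1 dF dF1 rF2.
have s00 : `|s0 - s0| <= d by rewrite subrr normr0 ltW.
pose K := 4 * geometric_mass R * tsum (fun k => a k * expR (- (2 * N k))).
apply: (@has_derive_quadratic _ _ _ _ _ (K * B) d0) => h hd.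
have hs : `|s0 + h - s0| <= d by rewrite addrAC subrr add0r.
rewrite -superB; [|exact: rF..].
rewrite -superZ// -superB; [|by apply: rapidB; exact: rF|exact: rapidZ].
rewrite -mulrA; apply: super_norm_bound => y.
have := @taylor_le _ (F ^~ y) (F1 ^~ y) (F2 ^~ y) s0 (s0 + h)
  (B * expR (- (2 * `|y|))).
rewrite [s0 + h - s0]addrAC subrr add0r => T.
rewrite [X in _ <= X]mulrAC -[h ^+ 2]real_normK ?num_real//.
by apply: T => z zs; [apply: dF|apply: dF1|apply: rF2]; exact: le_trans zs hd.
Qed.

End Superposition.

(** * Gaussian moments of a cloud *)

Section GaussianMoments.
Variable R : realType.
Implicit Types (t x y z : R) (j n m : nat).

(** The factor [t ^ (- 1/2)] of the heat kernel is left out: depending on time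
    only, it disappears in the Cole-Hopf quotient. *)
Definition gker j t z := z ^+ j * expR (- (z ^+ 2 / (4 * t))).

(** The inequality [r <= exp r] at [r = |z| / j], raised to the power [j]. *)
Lemma pow_le_expR j z : `|z| ^+ j <= j%:R ^+ j * expR `|z|.
Proof.
case: j => [|j]; first by rewrite !expr0 mul1r -expR0 ler_expR.
have j0 : 0 < j.+1%:R :> R by rewrite ltr0n.
have -> : expR `|z| = expR (`|z| / j.+1%:R) ^+ j.+1.
  by rewrite -expRM_natl -mulr_natl mulrCA divff ?mulr1// gt_eqF.
rewrite -exprMn lerXn2r ?nnegrE ?mulr_ge0 ?expR_ge0//.
rewrite -ler_pdivrMl// [_^-1 * _]mulrC.
by apply: le_trans (expR_ge1Dx _); rewrite lerDr.
Qed.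

Definition gker_bound j t := j%:R ^+ j * expR (25 * t).

Lemma gker_bound_ge0 j t : 0 <= gker_bound j t.
Proof. by rewrite mulr_ge0 ?expR_ge0// exprn_ge0. Qed.

Lemma gker_bound_le j t1 t2 : t1 <= t2 -> gker_bound j t1 <= gker_bound j t2.
Proof.
by move=> t12; rewrite ler_wpM2l ?exprn_ge0// ler_expR ler_wpM2l.
Qed.

(** The power [|z| ^ j] costs a factor [exp |z|], and completing the square
    gives [5 |z| - z ^ 2 / (4 t) <= 25 t]. *)
Lemma gker_le j t z : 0 < t -> `|gker j t z| <=
  gker_bound j t * expR (- (4 * `|z|)).
Proof.
move=> t0; rewrite normrM normrX (ger0_norm (expR_ge0 _)).
have -> : gker_bound j t * expR (- (4 * `|z|)) =
    (j%:R ^+ j * expR `|z|) * expR (25 * t - 5 * `|z|).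
  rewrite /gker_bound -!mulrA -!expRD; congr (_ * expR _); ring.
apply: ler_pM; rewrite ?exprn_ge0 ?expR_ge0 ?pow_le_expR// ler_expR.
rewrite -subr_ge0 -[z ^+ 2]real_normK ?num_real//.
have -> : 25 * t - 5 * `|z| - - (`|z| ^+ 2 / (4 * t)) =
    (`|z| - 10 * t) ^+ 2 / (4 * t) by field; rewrite gt_eqF.
by rewrite divr_ge0 ?sqr_ge0// mulr_ge0// ltW.
Qed.

Lemma gker0_gt0 t z : 0 < gker 0 t z.
Proof. by rewrite /gker expr0 mul1r expR_gt0. Qed.

Lemma gker_dz j t z : 0 < t -> has_derive (gker j t) z
  (j%:R * gker j.-1 t z - gker j.+1 t z / (2 * t)).
Proof.
move=> t0; apply: has_derive_eq.
  apply: (has_deriveM (has_deriveX j (has_derive_id z))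
    (has_derive_expR (has_deriveN
      (has_deriveM (has_deriveX 2 (has_derive_id z))
        (has_derive_cst z (4 * t)^-1))))).
by rewrite /gker/= (exprS z j); field; rewrite gt_eqF.
Qed.

Lemma gker_dx j t x y : 0 < t -> has_derive (fun x => gker j t (x - y)) x
  (j%:R * gker j.-1 t (x - y) - gker j.+1 t (x - y) / (2 * t)).
Proof.
move=> t0; apply: has_derive_eq.
  exact: (has_derive_comp (has_deriveB (has_derive_id x) (has_derive_cst x y))
    (gker_dz j (x - y) t0)).
by rewrite subr0 mul1r.
Qed.

Lemma gker_dt j t z : 0 < t -> has_derive (fun t => gker j t z) t
  (((2 * t) ^+ 2)^-1 * gker j.+2 t z).
Proof.
move=> t0; apply: has_derive_eq.
  apply: (has_deriveM (has_derive_cst t (z ^+ j))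
    (has_derive_expR (has_deriveN (has_deriveM (has_derive_cst t (z ^+ 2))
    (has_deriveV _ (has_deriveM (has_derive_cst t 4) (has_derive_id t))))))).
  by rewrite mulf_neq0 ?gt_eqF.
by rewrite /gker/= -[j.+2]addn2 exprD; field; rewrite gt_eqF.
Qed.

Lemma sqinv_dt t : 0 < t ->
  has_derive (fun t => ((2 * t) ^+ 2)^-1) t (- (2 * t ^+ 3)^-1).
Proof.
move=> t0; apply: has_derive_eq.
  apply: (has_deriveV _ (has_deriveX 2
    (has_deriveM (has_derive_cst t 2) (has_derive_id t)))).
  by rewrite expf_neq0// mulf_neq0 ?gt_eqF.
by rewrite /=; field; rewrite gt_eqF.
Qed.

(** Rapid decay with one constant for all parameters satisfying [P], as the
    remainder in [super_derive] requires. *)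
Definition urapid (P : R -> Prop) (F : R -> R -> R) : Prop :=
  exists B, forall s, P s -> rapid_by (F s) B.

Lemma urapid_rapid P F s : urapid P F -> P s -> rapid (F s).
Proof. by move=> [B H] Ps; exists B; exact: H. Qed.

Lemma urapidD P F G : urapid P F -> urapid P G ->
  urapid P (fun s y => F s y + G s y).
Proof.
move=> [B fB] [C gC]; exists (B + C) => s Ps y.
rewrite mulrDl; apply: (le_trans (ler_normD _ _)).
by apply: lerD; [exact: fB|exact: gC].
Qed.

Lemma urapidB P F G : urapid P F -> urapid P G ->
  urapid P (fun s y => F s y - G s y).
Proof.
move=> [B fB] [C gC]; exists (B + C) => s Ps y.
rewrite mulrDl; apply: (le_trans (ler_normB _ _)).
by apply: lerD; [exact: fB|exact: gC].
Qed.

Lemma urapidM P (k : R -> R) F K : (forall s, P s -> `|k s| <= K) ->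
  urapid P F -> urapid P (fun s y => k s * F s y).
Proof.
move=> kK [B fB]; exists (K * B) => s Ps y.
by rewrite normrM -mulrA ler_pM// ?kK ?fB.
Qed.

Lemma gker_rapid_by j t x : 0 < t ->
  rapid_by (fun y => gker j t (x - y)) (gker_bound j t * expR (2 * `|x|)).
Proof.
move=> t0 y; apply: (le_trans (gker_le j _ t0)).
rewrite -mulrA -expRD ler_wpM2l ?gker_bound_ge0// ler_expR.
have := ler_normB x (x - y); rewrite opprB addrCA subrr addr0.
by have := normr_ge0 (x - y); lra.
Qed.

Lemma gker_rapid j t x : 0 < t -> rapid (fun y => gker j t (x - y)).
Proof. by move=> t0; eexists; exact: gker_rapid_by. Qed.

Lemma gker_urapid_x j t x : 0 < t ->
  urapid (fun x' => `|x' - x| <= 1) (fun x' y => gker j t (x' - y)).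
Proof.
move=> t0; exists (gker_bound j t * expR (2 * (`|x| + 1))) => s sx y.
apply: (le_trans (gker_rapid_by j s t0 y)).
rewrite ler_wpM2r ?expR_ge0// ler_wpM2l ?gker_bound_ge0// ler_expR.
have := ler_normD (s - x) x; rewrite subrK; lra.
Qed.

Lemma gker_urapid_t j t x : 0 < t ->
  urapid (fun s => `|s - t| <= t / 2) (fun s y => gker j s (x - y)).
Proof.
move=> t0; exists (gker_bound j (2 * t) * expR (2 * `|x|)) => s st y.
have /andP[s1 s2] : t / 2 <= s <= 2 * t.
  by move: st; rewrite ler_distl => /andP[? ?]; apply/andP; split; lra.
have s0 : 0 < s by lra.
apply: (le_trans (gker_rapid_by j x s0 y)).
by rewrite ler_wpM2r ?expR_ge0// ler_wpM2r ?expR_ge0// gker_bound_le.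
Qed.

(** Cutting at [n = m] leaves two geometric series. *)
Lemma sum_exp_dist_le m :
  tsum (fun n => expR (- `|m%:R - n%:R|)) <= 2 * geometric_mass R.
Proof.
have part k : \sum_(0 <= n < k) expR (- n%:R) <= geometric_mass R.
  rewrite /geometric_mass (tsum_split k (@abs_summable_expN R)) lerDl.
  apply: tsum_ge0 => [n|]; first by case: ifP; rewrite ?expR_ge0.
  apply: abs_summable_le (@abs_summable_expN R) => n.
  by case: ifP; rewrite ?normr0 ?expR_ge0// ger0_norm ?expR_ge0.
have bnd k : \sum_(0 <= n < k) expR (- `|m%:R - n%:R| : R) <= 2 * geometric_mass
  R.
  have -> : 2 * geometric_mass R = geometric_mass R + geometric_mass R by ring.
  apply: (@le_trans _ _ (\sum_(0 <= n < m + k) expR (- `|m%:R - n%:R|))).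
    rewrite (@big_cat_nat _ _ _ k 0 (m + k))//= ?leq_addl// lerDl.
    by apply: sumr_ge0 => n _; exact: expR_ge0.
  rewrite (@big_cat_nat _ _ _ m 0 (m + k))//= ?leq_addr//; apply: lerD.
    apply: le_trans (part m); rewrite big_nat_rev/= !big_nat.
    apply: ler_sum => n /= nm; rewrite add0n ler_expR lerN2.
    rewrite -natrB ?leq_subr// subKn// normr_nat ler_nat//.
  apply: le_trans (part k); rewrite -{1}[m]add0n big_addn addKn.
  apply: ler_sum => n _; rewrite ler_expR lerN2.
  by rewrite distrC natrD addrK normr_nat.
have s : abs_summable (fun n => expR (- `|m%:R - n%:R|) : R).
  apply: (@abs_summable_le _ _ (fun n => expR m%:R * expR (- n%:R))).
    move=> n; rewrite ger0_norm ?expR_ge0// -expRD ler_expR.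
    have := ler_norm (n%:R - m%:R : R); rewrite distrC; lra.
  exact/abs_summableZ/abs_summable_expN.
apply: limr_le; first exact: abs_summable_cvg.
by apply: nearW => k; exact: bnd.
Qed.

(** Since 4 > 3, an integrand decaying at rate 4 around [x] sees mostly the part
    of the cloud near [x], so that its integral decays in [x - c] no slower than
    the cloud itself. Together with [cloud_gker_ge], this is the reason for
    using clouds: around a single point mass the heat kernel would have Gaussian
    decay, and the logarithmic derivative of the flow would be unbounded. *)
Lemma cloud_exp_le x c : cloud (fun y => expR (- (4 * `|x - y|))) c <=
  4 * expR 1 * geometric_mass R * expR (- (3 * `|x - c|)).
Proof.
set w := `|x - c|; pose m := Num.trunc w.
have w0 : 0 <= w by exact: normr_ge0.
have /andP[mw wm] := truncn_itv w0; rewrite -/m in mw wm.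
have sm : abs_summable (fun n => expR (- `|m%:R - n%:R|) : R).
  apply: (@abs_summable_le _ _ (fun n => expR m%:R * expR (- n%:R))).
    move=> n; rewrite ger0_norm ?expR_ge0// -expRD ler_expR.
    have := ler_norm (n%:R - m%:R : R); rewrite distrC; lra.
  exact/abs_summableZ/abs_summable_expN.
have point n r : `|w - n%:R| <= `|r| -> w <= n%:R + `|r| ->
    expR (- (3 * n%:R)) * expR (- (4 * `|r|)) <=
    expR 1 * expR (- (3 * w)) * expR (- `|m%:R - n%:R|).
  move=> h1 h2; rewrite -!expRD ler_expR.
  have := ler_normD (m%:R - w) (w - n%:R); rewrite addrA subrK.
  have : `|m%:R - w| <= 1.
    by rewrite distrC ger0_norm ?subr_ge0// lerBlDr addrC natr1 ltW.
  lra.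
have le n : `|cloud_term (fun y => expR (- (4 * `|x - y|))) c n| <=
    2 * expR 1 * expR (- (3 * w)) * expR (- `|m%:R - n%:R|).
  rewrite ger0_norm; last by rewrite mulr_ge0 ?addr_ge0 ?expR_ge0.
  have -> : 2 * expR 1 * expR (- (3 * w)) * expR (- `|m%:R - n%:R|) =
    expR 1 * expR (- (3 * w)) * expR (- `|m%:R - n%:R|) +
    expR 1 * expR (- (3 * w)) * expR (- `|m%:R - n%:R|) by ring.
  have nn : `|n%:R| = n%:R :> R by rewrite ger0_norm.
  rewrite /cloud_term mulrDr; apply: lerD; apply: point.
  - by rewrite -[n%:R]nn /w opprD addrA (le_trans (ler_dist_dist _ _))// nn.
  - have := ler_normD (x - (c + n%:R)) n%:R.
    by rewrite nn opprD addrA subrK -/w; lra.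
  - rewrite opprB addrA addrAC /w -[X in _ <= `|_ + X|]opprK.
    by apply: le_trans (ler_dist_dist _ _); rewrite normrN nn.
  - have := ler_normB (x - (c - n%:R)) n%:R.
    by rewrite nn opprB addrA addrAC addrK -/w; lra.
apply: le_trans (ler_norm _) _; apply: (le_trans (norm_tsum_le le _)).
  exact: abs_summableZ.
rewrite tsumZ//.
have -> : 4 * expR 1 * geometric_mass R * expR (- (3 * w)) =
  2 * expR 1 * expR (- (3 * w)) * (2 * geometric_mass R) by ring.
by rewrite ler_wpM2l ?sum_exp_dist_le// !mulr_ge0 ?expR_ge0.
Qed.

(** One of the point masses is at distance at most 1 from [x], and it alone
    gives the lower bound. *)
Lemma cloud_gker_ge t t1 x c : 0 < t1 -> t1 <= t ->
  expR (- (4 * t1)^-1) * expR (- (3 * `|x - c|)) <=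
  cloud (fun y => gker 0 t (x - y)) c.
Proof.
move=> t10 t1t; have t0 : 0 < t by exact: lt_le_trans t1t.
set w := `|x - c|; pose m := Num.trunc w.
have w0 : 0 <= w by exact: normr_ge0.
have /andP[mw wm] := truncn_itv w0; rewrite -/m in mw wm.
have g0 z : 0 <= gker 0 t z by rewrite ltW ?gker0_gt0.
apply: (@le_trans _ _ (cloud_term (fun y => gker 0 t (x - y)) c m)); last first.
  by apply: cloud_ge_term => [|y//]; exact/rapid_tame/gker_rapid.
have le r : `|r| <= 1 -> expR (- (4 * t1)^-1) <= gker 0 t r.
  move=> r1; rewrite /gker expr0 mul1r ler_expR lerN2 ler_pdivrMr ?mulr_gt0//.
  apply: (@le_trans _ _ 1).
    by rewrite -[r ^+ 2]real_normK ?num_real// expr_le1.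
  by rewrite mulrC ler_pdivlMr ?mulr_gt0// mul1r ler_wpM2l.
rewrite mulrC /cloud_term; apply: ler_pM; rewrite ?expR_ge0//.
  by rewrite ler_expR lerN2 ler_wpM2l.
have d1 : `|w - m%:R| <= 1.
  by rewrite ger0_norm ?subr_ge0// lerBlDr addrC natr1 ltW.
rewrite /w in d1; have [xc|xc] := leP 0 (x - c).
  apply: (le_trans (le (x - (c + m%:R)) _)).
    by move: d1; rewrite (ger0_norm xc) opprD addrA.
  by rewrite lerDl.
apply: (le_trans (le (x - (c - m%:R)) _)).
  rewrite opprB addrA addrAC.
  by move: d1; rewrite (ltr0_norm xc) -opprD normrN.
by rewrite lerDr.
Qed.

End GaussianMoments.

(** * The heat flow of a superposition *)

Section PartialsContinuous.
Variable R : realType.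

(** Joint continuity follows from continuity in [x] and from a Lipschitz bound
    in [t] that is uniform in [x]. *)
Lemma continuous_of_partial (F Ft : R -> R -> R) (t x d M : R) : 0 < d ->
  (forall s y, `|s - t| <= d -> `|y - x| <= d ->
    has_derive (F ^~ y) s (Ft s y) /\ `|Ft s y| <= M) ->
  {for x, continuous (F t)} ->
  {for (t, x), continuous (fun z : R * R => F z.1 z.2)}.
Proof.
move=> d0 dF cF; apply/cvgrPdist_le => e e0 /=.
have M0 : 0 <= M.
  have h := dF t x; rewrite !subrr !normr0 in h.
  by have [_] := h (ltW d0) (ltW d0); exact: le_trans.
have e1 : 0 < (e / 2) / (M + 1) by rewrite !divr_gt0//; lra.
have e2 : 0 < e / 2 by rewrite divr_gt0.
have nt : \forall z \near (t, x), `|z.1 - t| <= d /\ `|z.1 - t| <= (e / 2) /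
  (M + 1).
  have : \forall s \near t, `|s - t| <= d /\ `|s - t| <= (e / 2) / (M + 1).
    near=> s; split; near: s; apply/nbhs_ballP.
      by exists d => //= s; rewrite /ball/= distrC => /ltW.
    by exists (e / 2 / (M + 1)) => //= s; rewrite /ball/= distrC => /ltW.
  by move=> /(@cvg_fst _ _ (nbhs t) (nbhs x) _).
have nx : \forall z \near (t, x), `|z.2 - x| <= d /\ `|F t x - F t z.2| <= e /
  2.
  have : \forall y \near x, `|y - x| <= d /\ `|F t x - F t y| <= e / 2.
    near=> y; split; near: y.
      by apply/nbhs_ballP; exists d => //= s; rewrite /ball/= distrC => /ltW.
    by move/cvgrPdist_le : cF; exact.
  by move=> /(@cvg_snd _ _ (nbhs t) (nbhs x) _).
near=> z.
have [z1 z1'] : `|z.1 - t| <= d /\ `|z.1 - t| <= (e / 2) / (M + 1) by near: z.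
have [z2 z2'] : `|z.2 - x| <= d /\ `|F t x - F t z.2| <= e / 2 by near: z.
have h := @mvt_le _ (F ^~ z.2) (Ft ^~ z.2) t z.1 M.
have {}h : `|F z.1 z.2 - F t z.2| <= M * `|z.1 - t|.
  by apply: h => s sz; have [] := dF s z.2 (le_trans sz z1) z2.
have -> : F t x - F z.1 z.2 = (F t x - F t z.2) - (F z.1 z.2 - F t z.2) by ring.
apply: (le_trans (ler_normB _ _)); rewrite [leRHS](splitr e).
apply: lerD => //; apply: (le_trans h).
apply: (@le_trans _ _ ((M + 1) * `|z.1 - t|)).
  by rewrite ler_wpM2r//; lra.
by rewrite mulrC -ler_pdivlMr//; lra.
Unshelve. all: by end_near. Qed.

End PartialsContinuous.

Section Moments.
Variables (R : realType) (a N : nat -> R).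
Hypothesis a_ge0 : forall k, 0 <= a k.
Hypothesis a0_gt0 : 0 < a 0.
Hypothesis N_ge0 : forall k, 0 <= N k.
Hypothesis sum_aN : abs_summable (fun k => a k * expR (- (2 * N k))).
Implicit Types (t x y : R) (j : nat).

Local Notation superpose := (superpose a N).

Definition moment j t x := superpose (fun y => gker j t (x - y)).

Lemma moment_dx j t x : 0 < t -> has_derive (moment j t) x
  (j%:R * moment j.-1 t x - (2 * t)^-1 * moment j.+1 t x).
Proof.
move=> t0.
pose G1 i (s y : R) := i%:R * gker i.-1 t (s - y) - (2 * t)^-1 * gker i.+1 t
  (s - y).
have dG i s y : has_derive (fun s => gker i t (s - y)) s (G1 i s y).
  by apply: (has_derive_eq (gker_dx i s y t0)); rewrite /G1 (mulrC (2 * t)^-1).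
have ur i := gker_urapid_x i x t0.
have uG1 i : urapid (fun s => `|s - x| <= 1) (G1 i).
  by apply: urapidB; apply: (@urapidM _ _ (fun=> _) _ _ (fun _ _ => lexx _)).
have [B HB] : urapid (fun s => `|s - x| <= 1)
    (fun s y => j%:R * G1 j.-1 s y - (2 * t)^-1 * G1 j.+1 s y).
  by apply: urapidB; apply: (@urapidM _ _ (fun=> _) _ _ (fun _ _ => lexx _)).
apply: has_derive_eq.
  apply: (@super_derive _ a N a_ge0 N_ge0 sum_aN
    (fun s y => gker j t (s - y)) (G1 j) _ x 1 B ltr01 _ _ _ _ HB).
  - by move=> s _; exact: gker_rapid.
  - by apply: (urapid_rapid (uG1 j)); rewrite subrr normr0.
  - by move=> s y _; exact: dG.
  - move=> s y _; apply: has_derive_eq.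
      apply: (has_deriveB (has_deriveM (has_derive_cst s j%:R) (dG j.-1 s y))
        (has_deriveM (has_derive_cst s (2 * t)^-1) (dG j.+1 s y))).
    by rewrite !mul0r !add0r.
rewrite superB//; [|exact/rapidZ/gker_rapid..].
by rewrite !superZ//; exact: gker_rapid.
Qed.

(** Differentiating in [t] raises the degree by two, as differentiating twice in
    [x] does by [moment_dx]: this is the heat equation. *)
Lemma moment_dt j t x : 0 < t -> has_derive (fun t => moment j t x) t
  (((2 * t) ^+ 2)^-1 * moment j.+2 t x).
Proof.
move=> t0; have t2 : 0 < t / 2 by rewrite divr_gt0.
have pos s : `|s - t| <= t / 2 -> t / 2 <= s /\ 0 < s.
  by rewrite ler_distl => /andP[? ?]; split; lra.
pose k s : R := ((2 * s) ^+ 2)^-1.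
pose k' s : R := - (2 * s ^+ 3)^-1.
have kb s : `|s - t| <= t / 2 -> `|k s| <= k (t / 2).
  move=> /pos[ts s0]; rewrite ger0_norm ?invr_ge0 ?sqr_ge0//.
  rewrite lef_pV2 ?posrE ?exprn_gt0 ?mulr_gt0//.
  by apply: lerXn2r; rewrite ?nnegrE; lra.
have k'b s : `|s - t| <= t / 2 -> `|k' s| <= (2 * (t / 2) ^+ 3)^-1.
  move=> /pos[ts s0].
  rewrite normrN ger0_norm; last by rewrite invr_ge0 mulr_ge0 ?exprn_ge0 ?ltW.
  rewrite lef_pV2 ?posrE ?mulr_gt0 ?exprn_gt0// ler_wpM2l//.
  by apply: lerXn2r; rewrite ?nnegrE; lra.
have ur i := gker_urapid_t i x t0.
have dG i s y : 0 < s -> has_derive (fun s => gker i s (x - y)) s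
    (k s * gker i.+2 s (x - y)) by exact: gker_dt.
have [B HB] : urapid (fun s => `|s - t| <= t / 2)
    (fun s y => k' s * gker j.+2 s (x - y) +
                k s * (k s * gker j.+4 s (x - y))).
  apply: urapidD; first exact: urapidM k'b _.
  by apply: (urapidM kb); exact: urapidM kb _.
apply: has_derive_eq.
  apply: (@super_derive _ a N a_ge0 N_ge0 sum_aN
    (fun s y => gker j s (x - y)) (fun s y => k s * gker j.+2 s (x - y))
    _ t (t / 2) B t2 _ _ _ _ HB).
  - by move=> s /pos[_ s0]; exact: gker_rapid.
  - exact/rapidZ/gker_rapid.
  - by move=> s y /pos[_ s0]; exact: dG.
  - by move=> s y /pos[_ s0]; exact:
    (has_deriveM (sqinv_dt s0) (dG j.+2 s y s0)).
by rewrite superZ//; exact: gker_rapid.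
Qed.

Lemma moment_bounded j t x : 0 < t -> exists M, forall s y,
  `|s - t| <= t / 2 -> `|y - x| <= t / 2 -> `|moment j s y| <= M.
Proof.
move=> t0.
exists (4 * geometric_mass R * tsum (fun k => a k * expR (- (2 * N k))) *
  (gker_bound j (2 * t) * expR (2 * (`|x| + t)))) => s y st yx.
have /andP[s1 s2] : t / 2 <= s <= 2 * t.
  by move: st; rewrite ler_distl => /andP[? ?]; apply/andP; split; lra.
have s0 : 0 < s by lra.
apply: super_norm_bound => // z; apply: (le_trans (gker_rapid_by j y s0 z)).
rewrite ler_wpM2r ?expR_ge0//; apply: ler_pM; rewrite ?gker_bound_ge0
  ?expR_ge0//.
  by rewrite gker_bound_le.
rewrite ler_expR ler_wpM2l//.
by have := ler_normD (y - x) x; rewrite subrK; lra.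
Qed.

Lemma moment_continuous j t x : 0 < t ->
  {for (t, x), continuous (fun z : R * R => moment j z.1 z.2)}.
Proof.
move=> t0; have [M HM] := moment_bounded j.+2 x t0.
apply: (@continuous_of_partial _ (moment j)
  (fun t x => ((2 * t) ^+ 2)^-1 * moment j.+2 t x) t x (t / 2)
    ((t ^+ 2)^-1 * M)).
- by rewrite divr_gt0.
- move=> s y st yx; have /andP[s1 s2] : t / 2 <= s <= 2 * t.
    by move: st; rewrite ler_distl => /andP[? ?]; apply/andP; split; lra.
  have s0 : 0 < s by lra.
  split; first exact: moment_dt.
  rewrite normrM ler_pM// ?HM// ger0_norm ?invr_ge0 ?sqr_ge0//.
  rewrite lef_pV2 ?posrE ?exprn_gt0 ?mulr_gt0//.
  by apply: lerXn2r; rewrite ?nnegrE; lra.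
- exact: (has_derive_continuous (moment_dx j x t0)).
Qed.

Lemma moment0_gt0 t x : 0 < t -> 0 < moment 0 t x.
Proof.
move=> t0; apply: super_gt0 => //; first exact: gker_rapid.
by move=> y; exact: gker0_gt0.
Qed.

(** Cloud by cloud, both moments are compared with the decay of the cloud; the
    constant is uniform in [x], and this is what bounds the solution of Burgers'
    equation and its derivatives. *)
Lemma moment_le j t1 t2 : 0 < t1 -> exists C, forall t x, t1 <= t -> t <= t2 ->
  `|moment j t x| <= C * moment 0 t x.
Proof.
(* The constants of [gker_le], [cloud_exp_le] and [cloud_gker_ge]. *)
move=> t10; exists (gker_bound j t2 *
  (4 * expR 1 * geometric_mass R * expR (4 * t1)^-1)).
move=> t x t1t tt2; have t0 : 0 < t by exact: lt_le_trans t1t.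
have rg : rapid (fun y => expR (- (4 * `|x - y|)) : R).
  exists (expR (2 * `|x|)) => y; rewrite ger0_norm ?expR_ge0// -expRD ler_expR.
  have := ler_normB x (x - y); rewrite opprB addrCA subrr addr0.
  by have := normr_ge0 (x - y); lra.
apply: (@le_trans _ _ (superpose
  (fun y => gker_bound j t2 * expR (- (4 * `|x - y|))))).
  apply: super_norm_le => //; first exact: rapidZ.
  move=> y; apply: (le_trans (gker_le j _ t0)).
  by rewrite ler_wpM2r ?expR_ge0// gker_bound_le.
rewrite superZ// -[leRHS]mulrA ler_wpM2l ?gker_bound_ge0//.
apply: super_le_clouds => //; first exact: gker_rapid.
move=> c; apply: (le_trans (cloud_exp_le x c)).
rewrite -[leRHS]mulrA ler_wpM2l ?mulr_ge0 ?expR_ge0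
  ?(ltW (geometric_mass_gt0 R))//.
by rewrite -ler_pdivrMl ?expR_gt0// -expRN cloud_gker_ge.
Qed.

(** The flow and its first three derivatives in [x]. Time is shifted by 1, so
    that at time 0 the point masses are already spread into Gaussians and the
    initial datum is bounded. *)
Definition heat0 t x := moment 0 (1 + t) x.
Definition heat1 t x := - (2 * (1 + t))^-1 * moment 1 (1 + t) x.
Definition heat2 t x := (2 * (1 + t))^-1 ^+ 2 * moment 2 (1 + t) x
  - (2 * (1 + t))^-1 * moment 0 (1 + t) x.
Definition heat3 t x := 3 * (2 * (1 + t))^-1 ^+ 2 * moment 1 (1 + t) x
  - (2 * (1 + t))^-1 ^+ 3 * moment 3 (1 + t) x.

Definition superflow t x := - 2 * heat1 t x * (heat0 t x)^-1.

Lemma superflow_burgers : burgers_solution [set t : R | -1 < t] superflow /\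
  lipschitz_in_time [set t : R | -1 < t] superflow.
Proof.
have pos t : -1 < t -> 0 < 1 + t by move=> ?; lra.
have d1t (t : R) : has_derive (fun t => 1 + t) t 1.
  by apply: (has_derive_eq (has_deriveD (has_derive_cst t 1)
    (has_derive_id t))); rewrite add0r.
have dm j t x : -1 < t -> has_derive (fun t => moment j (1 + t) x) t
    ((2 * (1 + t))^-1 ^+ 2 * moment j.+2 (1 + t) x).
  move=> /pos t0; apply: has_derive_eq.
    exact: (@has_derive_comp _ (fun t => 1 + t) (fun t => moment j t x) _ _ _
      (d1t t) (moment_dt j x t0)).
  by rewrite mul1r exprVn.
have cm j t x : -1 < t ->
    {for (t, x), continuous (fun z : R * R => moment j (1 + z.1) z.2)}.
  move=> /pos t0.
  apply: (@continuous_comp _ _ _ (fun z : R * R => (1 + z.1, z.2))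
    (fun z : R * R => moment j z.1 z.2)); last exact: moment_continuous.
  apply: (@cvg_pair _ _ _ _ (nbhs (1 + t)) (nbhs x)); last exact: cvg_snd.
  by apply: cvgD; [exact: cvg_cst|exact: cvg_fst].
have cV t x : -1 < t ->
    {for (t, x), continuous (fun z : R * R => (2 * (1 + z.1))^-1)}.
  move=> /pos t0; apply: continuous_forV; first by rewrite mulf_neq0 ?gt_eqF.
  apply: continuous_forM; first exact: continuous_for_cst.
  by apply: cvgD; [exact: cvg_cst|exact: cvg_fst].
apply: (@cole_hopf _ _ heat0 heat1 heat2 heat3 (fun t => (2 * (1 + t))^-1)).
- exact: open_gt.
- by move=> t x /pos t0; exact: moment0_gt0.
- move=> t x /pos t0; apply: (has_derive_eq (moment_dx 0 x t0)).
  by rewrite /heat1 mul0r sub0r mulNr.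
- move=> t x /pos t0; apply: has_derive_eq.
    exact: (has_deriveM (has_derive_cst x _) (moment_dx 1 x t0)).
  by rewrite /heat2/=; set w := (2 * _)^-1; ring.
- move=> t x /pos t0; apply: has_derive_eq.
    exact: (has_deriveB (has_deriveM (has_derive_cst x _) (moment_dx 2 x t0))
      (has_deriveM (has_derive_cst x _) (moment_dx 0 x t0))).
  by rewrite /heat3/=; set w := (2 * _)^-1; ring.
- move=> t x It; apply: (has_derive_eq (dm 0 t x It)).
  by rewrite /heat2 /heat0; ring.
- move=> t x It; have t0 := pos t It; apply: has_derive_eq.
    apply: (has_deriveM (has_deriveN
      (has_deriveV _ (has_deriveM (has_derive_cst t 2) (d1t t))))
        (dm 1 t x It)).
    by rewrite mulf_neq0 ?gt_eqF.
  by rewrite /heat3 /heat1/=; field; rewrite gt_eqF.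
- move=> t x It; have cVt := cV t x It; split.
  + exact: cm.
  + refine (continuous_forM _ (cm 1 t x It)).
    rewrite (_ : (fun z : R * R => _) =
      (fun z : R * R => (-1) * (2 * (1 + z.1))^-1)).
      by refine (continuous_forM _ cVt); exact: continuous_for_cst.
    by apply/funext => z; rewrite mulN1r.
  + exact: (continuous_forB (continuous_forM (continuous_forX cVt)
    (cm 2 t x It))
      (continuous_forM cVt (cm 0 t x It))).
  + refine (continuous_forB (continuous_forM
    (continuous_forM _ (continuous_forX cVt))
      (cm 1 t x It)) (continuous_forM (continuous_forX cVt) (cm 3 t x It))).
    exact: continuous_for_cst.
- move=> t It; have t0 := pos t It.
  have t2 : 0 < (1 + t) / 2 by rewrite divr_gt0.
  have [C1 H1] := moment_le 1 (2 * (1 + t)) t2.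
  have [C2 H2] := moment_le 2 (2 * (1 + t)) t2.
  have [C3 H3] := moment_le 3 (2 * (1 + t)) t2.
  pose v := (1 + t)^-1.
  pose D1 := `|C1|; pose D2 := `|C2|; pose D3 := `|C3|.
  have v0 : 0 < v by rewrite invr_gt0.
  exists (v * D1 + (v ^+ 2 * D2 + v) + (3 * v ^+ 2 * D1 + v ^+ 3 * D3)),
    ((1 + t) / 2).
  split => // s x st.
  have /andP[s1 s2] : (1 + t) / 2 <= 1 + s <= 2 * (1 + t).
    by move: st; rewrite ler_distl => /andP[? ?]; apply/andP; split; lra.
  have s0 : 0 < 1 + s by lra.
  split; first by rewrite /=; lra.
  have m0 := moment0_gt0 x s0.
  have up (C m : R) : `|m| <= C * moment 0 (1 + s) x -> `|m| <= `|C| * moment 0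
    (1 + s) x.
    move/le_trans; apply; rewrite ler_wpM2r ?ler_norm//; exact: ltW.
  have {}H1 := up _ _ (H1 _ x s1 s2).
  have {}H2 := up _ _ (H2 _ x s1 s2).
  have {}H3 := up _ _ (H3 _ x s1 s2).
  rewrite -/D1 -/D2 -/D3 in H1 H2 H3.
  have D10 : 0 <= D1 by exact: normr_ge0.
  have D20 : 0 <= D2 by exact: normr_ge0.
  have D30 : 0 <= D3 by exact: normr_ge0.
  set w := (2 * (1 + s))^-1.
  have w0 : 0 < w by rewrite invr_gt0 mulr_gt0.
  have wv : w <= v by rewrite lef_pV2 ?posrE ?mulr_gt0//; lra.
  have wvX n : w ^+ n <= v ^+ n by rewrite lerXn2r// nnegrE ltW.
  rewrite /heat1 /heat2 /heat3 /heat0 -/w.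
  move: (moment 0 (1 + s) x) m0 H1 H2 H3 => m m0.
  move: (moment 1 (1 + s) x) (moment 2 (1 + s) x) (moment 3 (1 + s) x)
    => m1 m2 m3 H1 H2 H3.
  have step n (D z : R) : 0 <= D -> `|z| <= D * m -> `|w ^+ n * z| <= v ^+ n * D
    * m.
    move=> D0 zD; rewrite normrM -mulrA ler_pM//.
    by rewrite ger0_norm ?exprn_ge0// ltW.
  have h1 := step 1 _ _ D10 H1; rewrite !expr1 in h1.
  have h2 := step 2 _ _ D20 H2.
  have h3 := step 3 _ _ D30 H3.
  have h4 := step 2 _ _ D10 H1.
  have h0 : `|w * m| <= v * m.
    by rewrite ger0_norm ?ler_wpM2r ?mulr_ge0// ltW.
  have e1 : 0 <= v * D1 * m by rewrite !mulr_ge0// ltW.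
  have e2 : 0 <= v ^+ 2 * D2 * m by rewrite !mulr_ge0 ?exprn_ge0// ltW.
  have e3 : 0 <= v ^+ 3 * D3 * m by rewrite !mulr_ge0 ?exprn_ge0// ltW.
  have e4 : 0 <= v ^+ 2 * D1 * m by rewrite !mulr_ge0 ?exprn_ge0// ltW.
  have e0 : 0 <= v * m by rewrite !mulr_ge0// ltW.
  have -> : (v * D1 + (v ^+ 2 * D2 + v) + (3 * v ^+ 2 * D1 + v ^+ 3 * D3)) * m =
    v * D1 * m + (v ^+ 2 * D2 * m + v * m) +
      (3 * (v ^+ 2 * D1 * m) + v ^+ 3 * D3 * m).
    by ring.
  split.
  + by rewrite mulNr normrN; apply: (le_trans h1); lra.
  + by apply: (le_trans (ler_normB _ _)); apply: (le_trans (lerD h2 h0)); lra.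
  + apply: (le_trans (ler_normB _ _)).
    rewrite -mulrA normrM (ger0_norm (ler0n _ 3)).
    apply: (@le_trans _ _ (3 * (v ^+ 2 * D1 * m) + v ^+ 3 * D3 * m)); last by
      lra.
    by apply: lerD => //; rewrite ler_wpM2l.
Qed.

End Moments.

(** * The merger of two shocks *)

Section Merger.
Variable R : realType.
Implicit Types t x : R.

(** The three exponentials [exp (c x + c ^ 2 t)], [c = 0, 1, -1], solve the heat
    equation; under Cole-Hopf each of them alone is the constant state [- 2 c],
    and a change of the dominant one is a shock. *)
Definition merger0 t x : R := 1 + expR t * (expR x + expR (- x)).
Definition merger1 t x : R := expR t * (expR x - expR (- x)).
Definition merger2 t x : R := expR t * (expR x + expR (- x)).

Definition merger t x : R := - 2 * merger1 t x * (merger0 t x)^-1.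

Lemma merger0_gt1 t x : 1 < merger0 t x.
Proof. by rewrite /merger0 ltrDl mulr_gt0 ?expR_gt0// addr_gt0 ?expR_gt0. Qed.

Lemma merger0_gt0 t x : 0 < merger0 t x.
Proof. exact: lt_trans (merger0_gt1 t x). Qed.

Lemma merger0_dx t x : has_derive (merger0 t) x (merger1 t x).
Proof.
have dN := has_derive_expR (has_deriveN (has_derive_id x)).
apply: has_derive_eq.
  exact: (has_deriveD (has_derive_cst x 1)
    (has_deriveM (has_derive_cst x (expR t))
      (has_deriveD (has_derive_expR (has_derive_id x)) dN))).
by rewrite /merger1; ring.
Qed.

Lemma merger1_dx t x : has_derive (merger1 t) x (merger2 t x).
Proof.
have dN := has_derive_expR (has_deriveN (has_derive_id x)).
apply: has_derive_eq.
  exact: (has_deriveM (has_derive_cst x (expR t))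
    (has_deriveB (has_derive_expR (has_derive_id x)) dN)).
by rewrite /merger2; ring.
Qed.

Lemma merger2_dx t x : has_derive (merger2 t) x (merger1 t x).
Proof.
have dN := has_derive_expR (has_deriveN (has_derive_id x)).
apply: has_derive_eq.
  exact: (has_deriveM (has_derive_cst x (expR t))
    (has_deriveD (has_derive_expR (has_derive_id x)) dN)).
by rewrite /merger1; ring.
Qed.

Lemma merger_entire : entire_solution merger.
Proof.
have ce1 t x : {for (t, x), continuous (fun z : R * R => expR z.1)}.
  by apply: (@continuous_comp _ _ _ fst expR);
    [exact: cvg_fst|exact: continuous_expR].
have ce2 t x : {for (t, x), continuous (fun z : R * R => expR z.2)}.
  by apply: (@continuous_comp _ _ _ snd expR);
    [exact: cvg_snd|exact: continuous_expR].
have ce3 t x : {for (t, x), continuous (fun z : R * R => expR (- z.2))}.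
  apply: (@continuous_comp _ _ _ (fun z : R * R => - z.2) expR).
    by apply: cvgN; exact: cvg_snd.
  exact: continuous_expR.
have c1 t x := continuous_forM (ce1 t x) (continuous_forB (ce2 t x) (ce3 t x)).
have c2 t x := continuous_forM (ce1 t x) (continuous_forD (ce2 t x) (ce3 t x)).
suff [] : burgers_solution setT merger /\ lipschitz_in_time setT merger by [].
apply: (@cole_hopf _ setT merger0 merger1 merger2 merger1 (fun=> 0)).
- exact: openT.
- by move=> t x _; exact: merger0_gt0.
- by move=> t x _; exact: merger0_dx.
- by move=> t x _; exact: merger1_dx.
- by move=> t x _; exact: merger2_dx.
- move=> t x _; apply: has_derive_eq.
    exact: (has_deriveD (has_derive_cst t 1)
      (has_deriveM (has_derive_expR (has_derive_id t)) (has_derive_cst t _))).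
  by rewrite /merger2; ring.
- move=> t x _; apply: has_derive_eq.
    exact: (has_deriveM (has_derive_expR (has_derive_id t))
      (has_derive_cst t _)).
  by rewrite /merger1; ring.
- move=> t x _; split; [|exact: c1|exact: c2|exact: c1].
  by refine (continuous_forD _ (c2 t x)); exact: continuous_for_cst.
- move=> t _; exists 1, 1; split => // s x _; split=> //.
  have le2 : merger2 s x <= 1 * merger0 s x by rewrite mul1r lerDr.
  have m2 : 0 <= merger2 s x by rewrite mulr_ge0 ?addr_ge0 ?expR_ge0.
  have le1 : `|merger1 s x| <= 1 * merger0 s x.
    apply: le_trans le2; rewrite /merger1 normrM ger0_norm ?expR_ge0//.
    rewrite ler_wpM2l ?expR_ge0// (le_trans (ler_normB _ _))//.
    by rewrite !ger0_norm ?expR_ge0.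
  by rewrite (ger0_norm m2).
Qed.

Lemma merger_dx t x : has_derive (merger t) x
  (- 2 * (merger2 t x * (merger0 t x)^-1 - (merger1 t x * (merger0 t x)^-1) ^+
    2)).
Proof.
have p0 : merger0 t x != 0 by rewrite gt_eqF ?merger0_gt0.
apply: has_derive_eq.
  exact: (has_deriveM (has_deriveM (has_derive_cst x (-2)) (merger1_dx t x))
    (has_deriveV p0 (merger0_dx t x))).
by rewrite /=; field.
Qed.

Lemma merger0N t x : merger0 t (- x) = merger0 t x.
Proof. by rewrite /merger0 opprK (addrC (expR (- x))). Qed.

Lemma merger1N t x : merger1 t (- x) = - merger1 t x.
Proof. by rewrite /merger1 opprK -mulrN opprB. Qed.

Lemma merger2N t x : merger2 t (- x) = merger2 t x.
Proof. by rewrite /merger2 opprK (addrC (expR (- x))). Qed.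

Lemma merger_odd t x : merger t (- x) = - merger t x.
Proof. by rewrite /merger merger0N merger1N mulrN mulNr. Qed.

Lemma merger_1 t : merger t 1 != 0.
Proof.
apply: mulf_neq0; last by rewrite invr_eq0 gt_eqF ?merger0_gt0.
apply: mulf_neq0; first by rewrite oppr_eq0 pnatr_eq0.
by rewrite gt_eqF// mulr_gt0 ?expR_gt0// subr_gt0 ltr_expR; lra.
Qed.

Lemma merger_not_cst t : ~ (exists c : R, forall x : R, merger t x = c).
Proof.
move=> [c H]; have := merger_odd t 1; rewrite !H => /eqP.
by rewrite -addr_eq0 -mulr2n mulrn_eq0/= -(H 1) (negbTE (merger_1 t)).
Qed.

Lemma shock_dx (beta alpha y : R) : has_derive (shock beta alpha) y
  (((shock beta alpha y - (alpha + beta) / 2) ^+ 2 - ((beta - alpha) / 2) ^+ 2)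
    / 2).
Proof.
pose c := (alpha + beta) / 2; pose d := (beta - alpha) / 2.
have -> : shock beta alpha = (fun y => c - d *
    ((expR (d * y / 2) - expR (- (d * y / 2))) *
     (expR (d * y / 2) + expR (- (d * y / 2)))^-1)) by [].
rewrite -/c -/d.
have den : expR (d * y / 2) + expR (- (d * y / 2)) != 0.
  by rewrite gt_eqF// addr_gt0 ?expR_gt0.
have dl := has_deriveM (has_deriveM (has_derive_cst y d) (has_derive_id y))
  (has_derive_cst y 2^-1).
have dE := has_derive_expR dl.
have dN := has_derive_expR (has_deriveN dl).
apply: has_derive_eq.
  by apply: (has_deriveB (has_derive_cst y c)
    (has_deriveM (has_derive_cst y d)
      (has_deriveM (has_deriveB dE dN) (has_deriveV _ (has_deriveD dE dN))))).
move: den; set X := expR (d * y / 2); set Y := expR (- _) => den /=.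
by field.
Qed.

(** A shock profile satisfies [v' = ((v - c) ^ 2 - d ^ 2) / 2]. As the merger is
    odd, the equation at [x = 1] and [x = -1] forces [c = 0]; then it says that
    [merger2 / merger0] does not depend on [x], which fails because cosh is not
    constant. *)
Lemma merger_not_shock t : ~ (exists alpha beta x0 : R, alpha < beta /\
  forall x : R, merger t x = shock beta alpha (x - x0)).
Proof.
move=> [alpha [beta [x0 [_ H]]]].
set c := (alpha + beta) / 2; set d := (beta - alpha) / 2.
have ode x : - 2 * (merger2 t x * (merger0 t x)^-1 -
    (merger1 t x * (merger0 t x)^-1) ^+ 2) = ((merger t x - c) ^+ 2 - d ^+ 2) /
      2.
  have [_ <-] := merger_dx t x.
  have -> : merger t = (fun x => shock beta alpha (x - x0)) by exact/funext.
  have [_ ->] := has_derive_comp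
    (has_deriveB (has_derive_id x) (has_derive_cst x x0))
      (shock_dx beta alpha (x - x0)).
  by rewrite subr0 mul1r.
have c0 : c = 0.
  have h1 := ode 1; have h2 := ode (-1).
  rewrite merger0N merger1N merger2N merger_odd (mulNr (merger1 t 1)) sqrrN h1
    in h2.
  have : merger t 1 * c = 0 by move: h2; set m := merger t 1; lra.
  by move/eqP; rewrite mulf_eq0 (negbTE (merger_1 t))/= => /eqP.
have key x : merger2 t x * (merger0 t x)^-1 = d ^+ 2 / 4.
  have := ode x; rewrite c0 subr0.
  have -> : merger t x = - 2 * (merger1 t x * (merger0 t x)^-1) by rewrite
    mulrA.
  by set m := merger1 t x * _; lra.
have E : merger2 t 0 * merger0 t 1 = merger2 t 1 * merger0 t 0.
  have n0 : merger0 t 0 != 0 by rewrite gt_eqF ?merger0_gt0.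
  have n1 : merger0 t 1 != 0 by rewrite gt_eqF ?merger0_gt0.
  by apply/eqP; rewrite -eqr_div// !key.
(* As [merger0 = 1 + merger2], the products cancel. *)
have {}E : merger2 t 0 = merger2 t 1.
  by move: E; rewrite /merger0 -/(merger2 t 0) -/(merger2 t 1); lra.
move: E; rewrite /merger2 oppr0 expR0 => /(mulfI (lt0r_neq0 (expR_gt0 t))) E.
have gt1 : 1 < expR 1 :> R by rewrite expR_gt1.
have : expR 1 * expR (-1) = 1 :> R by rewrite -expRD subrr expR0.
have : 0 < (expR 1 - 1) ^+ 2 :> R by rewrite exprn_gt0// subr_gt0.
have -> : expR (-1) = 2 - expR 1 :> R by lra.
by nra.
Qed.

Lemma sup_norm_cvg0 (F : set_system R) (FF : Filter F) (f : R -> R -> R)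
  (g : R -> R) :
  (forall t x, `|f t x| <= g t) -> g t @[t --> F] --> (0 : R) ->
  sup_norm (f t) @[t --> F] --> 0%E.
Proof.
move=> fg g0; apply: (@squeeze_cvge _ _ _ _ (cst 0%E) _ (fun t => (g t)%:E)).
- apply: nearW => t; apply/andP; split.
    apply: (@le_trans _ _ `|f t 0|%:E); first by rewrite lee_fin.
    by apply: ereal_sup_ubound; exists 0.
  by apply: ge_ereal_sup => _ [x _ <-]; rewrite lee_fin.
- exact: cvg_cst.
- by apply: cvg_EFin; [exact: nearW|exact: g0].
Qed.

(** Written as a logistic function, the profile is a quotient of exponentials
    that can be compared with the merger by algebra. *)
Lemma shock_exp (beta alpha y : R) :
  shock beta alpha y = alpha + (beta - alpha) /
    (1 + expR ((beta - alpha) / 2 * y)).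
Proof.
rewrite /shock /tanh; set d := (beta - alpha) / 2.
set X := expR (d * y / 2).
have X0 : 0 < X by exact: expR_gt0.
have -> : expR (d * y) = X ^+ 2.
  by rewrite /X -expRM_natl; congr expR; field.
have -> : expR (- (d * y / 2)) = X^-1 by rewrite expRN.
rewrite /d; field; rewrite !gt_eqF ?addr_gt0 ?exprn_gt0//.
Qed.

(** The difference with the limiting profiles is explicit. It is at most
    [exp (- t)] as [t] tends to [+oo]; with [a = exp (t + x)] and
    [b = exp (t - x)], it is at most [2 a b = 2 exp (2 t)] as [t] tends to
    [-oo]. *)
Lemma merger_is_shock_merger : shock_merger merger.
Proof.
exists (-2), 0, 2, 0, 0, 0; split; [by rewrite oppr_lt0|by []| |].
- apply: (@sup_norm_cvg0 _ _ _ (fun t => expR (- t))); last exact: cvgr_expR.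
  move=> t x; rewrite shock_exp addNr mul0r mul0r !subr0.
  have -> : (2 - -2) / 2 * x = 2 * x by field.
  rewrite /merger /merger0 /merger1.
  have -> : expR (2 * x) = expR x ^+ 2 by rewrite -expRM_natl.
  rewrite !expRN; set E := expR t; set X := expR x.
  have E0 : 0 < E by exact: expR_gt0.
  have X0 : 0 < X by exact: expR_gt0.
  have -> : - 2 * (E * (X - X^-1)) / (1 + E * (X + X^-1)) -
      (-2 + (2 - -2) / (1 + X ^+ 2)) =
      E^-1 * (2 * (X ^+ 2 - 1) * X / ((X ^+ 2 + 1) * (X / E + (X ^+ 2 + 1)))).
    field.
    by rewrite !gt_eqF// !addr_gt0// ?mulr_gt0// ?addr_gt0// exprn_gt0.
  have iE0 : 0 < E^-1 by rewrite invr_gt0.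
  rewrite normrM (gtr0_norm iE0) ger_pMr//.
  have XE : 0 < X / E by rewrite divr_gt0.
  have D0 : 0 < (X ^+ 2 + 1) * (X / E + (X ^+ 2 + 1)).
    by rewrite mulr_gt0 ?addr_gt0 ?exprn_gt0.
  rewrite normrM normfV (gtr0_norm D0) ler_pdivrMr// mul1r.
  have X2 := exprn_gt0 2 X0.
  rewrite ler_norml; apply/andP; split.
    by nra.
  by nra.
- apply: (@sup_norm_cvg0 _ _ _ (fun t => 2 * (expR t * expR t))).
    move=> t x; rewrite !shock_exp.
    have -> : (2 - 0) / 2 * (x - (2 + 0) / 2 * t - 0) = x - t by field.
    have -> : (0 - -2) / 2 * (x - (0 + -2) / 2 * t - 0) = x + t by field.
    rewrite /merger /merger0 /merger1 !expRD !expRN.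
    set E := expR t; set X := expR x.
    have E0 : 0 < E by exact: expR_gt0.
    have X0 : 0 < X by exact: expR_gt0.
    set a := E * X; set b := E / X.
    have a0 : 0 < a by rewrite mulr_gt0.
    have b0 : 0 < b by rewrite divr_gt0.
    have ab : a * b = E * E by rewrite /a /b; field; rewrite gt_eqF.
    have -> : - 2 * (E * (X - X^-1)) / (1 + E * (X + X^-1)) -
       (0 + (2 - 0) / (1 + X / E)) - (-2 + (0 - -2) / (1 + X * E)) + 0 =
       2 * ((a * b) / ((1 + a) * (1 + a + b)) - (a * b) /
         ((1 + b) * (1 + a + b))).
      rewrite /a /b; field.
      by rewrite !gt_eqF ?addr_gt0 ?mulr_gt0 ?exprn_gt0 ?addr_gt0 ?mulr_gt0.
    rewrite -ab; have ab0 : 0 < a * b by rewrite mulr_gt0.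
    have bd c : 0 < c -> 0 < a * b / ((1 + c) * (1 + a + b)) <= a * b.
      move=> c0; have cc : 0 < (1 + c) * (1 + a + b) by rewrite mulr_gt0
        ?addr_gt0.
      rewrite divr_gt0//= ler_pdivrMr// ler_peMr ?(ltW ab0)//.
      by nra.
    have /andP[h1 h2] := bd _ a0; have /andP[h3 h4] := bd _ b0.
    rewrite normrM ger0_norm// ler_wpM2l// ler_norml; apply/andP; split; lra.
  have eN : expR t @[t --> -oo] --> (0 : R).
    apply/cvgNy_compNP; under eq_fun do rewrite /=.
    exact: cvgr_expR.
  rewrite -[X in _ --> X](mulr0 2); apply: cvgM; first exact: cvg_cst.
  by rewrite -[X in _ --> X](mulr0 0); exact: cvgM.
Qed.

End Merger.

(** * Sites and weights of the clouds *)

Section Weights.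
Variable R : realType.
Implicit Types (k n : nat).

(** These are the times at which two shocks merge. Growing like iterated cubes,
    they make the distance [2 * stage k] of the [k]-th clouds negligible with
    respect to the square root of [stage k.+1]: at that time, the previous
    clouds act as one mass at the origin. *)
Fixpoint stage k : R := if k is k'.+1 then stage k' ^+ 3 else 8.

Lemma stage_ge8 k : 8 <= stage k.
Proof.
elim: k => //= k ih; have h0 : 0 <= stage k by lra.
have : 64 <= stage k ^+ 2 by rewrite expr2; nra.
by rewrite (exprS _ 2); nra.
Qed.

Lemma stage_gt0 k : 0 < stage k.
Proof. by have := stage_ge8 k; lra. Qed.

Lemma stageS k : 64 * stage k <= stage k.+1.
Proof.
have h := stage_ge8 k; have : 64 <= stage k ^+ 2 by rewrite expr2; nra.
by rewrite /= (exprS _ 2); nra.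
Qed.

Lemma stage_ge_nat k : k%:R <= stage k.
Proof.
elim: k => [|k ih]; first exact: ltW (stage_gt0 0).
have := stageS k; have := stage_ge8 k; rewrite -natr1; lra.
Qed.

Lemma stage_le j k : (j <= k)%N -> stage j <= stage k.
Proof.
elim: k => [|k ih]; first by rewrite leqn0 => /eqP ->.
rewrite leq_eqVlt => /predU1P[->//|/ih h].
by have := stageS k; have := stage_gt0 k; lra.
Qed.

Lemma tame_cst c : tame (fun=> 1 : R) c.
Proof.
exists 1 => n; rewrite normr1 mul1r; split;
  by rewrite -expR0 ler_expR mulr_ge0.
Qed.

Lemma tame_expN c : tame (fun y : R => expR (- (y - c))) c.
Proof.
exists 1 => n; rewrite !ger0_norm ?expR_ge0// mul1r !ler_expR.
by have := ler0n R n; split; lra.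
Qed.

Lemma tame_expP c : tame (fun y : R => expR (y - c)) c.
Proof.
exists 1 => n; rewrite !ger0_norm ?expR_ge0// mul1r !ler_expR.
by have := ler0n R n; split; lra.
Qed.

Definition mass : R := cloud (fun=> 1) 0.
(** At time [T], a cloud of centre [2 T] sees near the origin the kernel as an
    exponential of rate 1; this is the integral of that exponential. *)
Definition tilted_mass : R := cloud (fun y : R => expR (- y)) 0.

Lemma cloud_expN c : cloud (fun y : R => expR (- (y - c))) c = tilted_mass.
Proof.
congr tsum; apply/funext => n; rewrite /cloud_term; congr (_ * _).
have -> : c + n%:R - c = n%:R by ring.
have -> : c - n%:R - c = - n%:R by ring.
by rewrite add0r sub0r.
Qed.

Lemma cloud_expP c : cloud (fun y : R => expR (y - c)) c = tilted_mass.
Proof.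
congr tsum; apply/funext => n; rewrite /cloud_term; congr (_ * _).
have -> : c + n%:R - c = n%:R by ring.
have -> : c - n%:R - c = - n%:R by ring.
by rewrite add0r sub0r opprK addrC.
Qed.

Lemma mass_gt0 : 0 < mass.
Proof.
apply: (@lt_le_trans _ _ (cloud_term (fun=> 1 : R) 0 0)).
  by rewrite mulr_gt0 ?expR_gt0// addr_gt0.
by apply: cloud_ge_term => //; exact: tame_cst.
Qed.

Lemma mass_le_tilted : mass <= tilted_mass.
Proof.
have tN : tame (fun y : R => expR (- y)) 0.
  by have := tame_expN 0; under eq_fun do rewrite subr0.
apply: le_tsum => [||n]; [exact/summable_cloud/tame_cst|exact: summable_cloud|].
rewrite ler_wpM2l ?expR_ge0// sub0r add0r opprK.
have := expR_ge1Dx (- n%:R : R); have := expR_ge1Dx (n%:R : R); lra.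
Qed.

Lemma tilted_gt0 : 0 < tilted_mass.
Proof. exact: lt_le_trans mass_gt0 mass_le_tilted. Qed.

(** Tuned so that, at time [stage k.+1], the clouds of index at most [k] and
    each of the two clouds of index [k.+1] contribute with equal factors. *)
Definition rho : R := 2 * mass / tilted_mass.

Lemma rho_gt0 : 0 < rho.
Proof. by rewrite divr_gt0 ?tilted_gt0// mulr_gt0 ?mass_gt0. Qed.

Lemma rho_le2 : rho <= 2.
Proof.
by rewrite ler_pdivrMr ?tilted_gt0// ler_wpM2l ?mass_le_tilted.
Qed.

(** The product formula for the sum of the weights up to [k], in which
    [cloud_weight] can be expressed (see [inner_weightE]). *)
Fixpoint inner_weight k : R :=
  if k is k'.+1 then inner_weight k' * (1 + rho * expR (stage k)) else 1.

(** The factor [exp (stage k)] compensates the loss of the heat kernel at time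
    [stage k] over the distance [2 * stage k]. *)
Definition cloud_weight k : R :=
  if k is k'.+1 then rho * expR (stage k) * inner_weight k' else 1.

Lemma inner_weight_ge1 k : 1 <= inner_weight k.
Proof.
elim: k => //= k ih; rewrite -[leLHS]mulr1 ler_pM//.
by rewrite lerDl mulr_ge0 ?expR_ge0 ?(ltW rho_gt0).
Qed.

Lemma inner_weight_gt0 k : 0 < inner_weight k.
Proof. exact: lt_le_trans (inner_weight_ge1 k). Qed.

Lemma inner_weightE k : \sum_(0 <= j < k.+1) cloud_weight j = inner_weight k.
Proof.
elim: k => [|k ih]; first by rewrite big_nat1.
by rewrite big_nat_recr//= ih; ring.
Qed.

Lemma weight_ge0 k : 0 <= cloud_weight k.
Proof.
case: k => //= k; have w0 := inner_weight_gt0 k.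
apply: mulr_ge0; last exact: ltW.
by apply: mulr_ge0; [exact: ltW rho_gt0|exact: expR_ge0].
Qed.

Lemma expR1_ge2 : 2 <= expR 1 :> R.
Proof. by have := expR_ge1Dx (1 : R); lra. Qed.

Lemma inner_weight_le k : inner_weight k <= expR (2 * stage k).
Proof.
elim: k => [|k ih]; first by rewrite /= -[leLHS]expR0 ler_expR; lra.
apply: (@le_trans _ _ (expR (2 * stage k) * expR (stage k.+1 + 2))); last first.
  rewrite -expRD ler_expR; have := stageS k; have := stage_ge8 k; lra.
rewrite [inner_weight k.+1]/=.
apply: ler_pM => //; first exact: ltW (inner_weight_gt0 k).
  by rewrite addr_ge0// mulr_ge0 ?expR_ge0 ?(ltW rho_gt0).
have e1 : 1 <= expR (stage k ^+ 3).
  by rewrite -[leLHS]expR0 ler_expR exprn_ge0// ltW ?stage_gt0.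
have e2 : 3 <= expR 2 :> R by have := expR_ge1Dx (2 : R); lra.
rewrite expRD; set E := expR (stage k ^+ 3) in e1 *.
by have := rho_le2; have := rho_gt0; nra.
Qed.

Lemma weight_le k : cloud_weight k <= expR (2 * stage k).
Proof.
case: k => [|k]; first by rewrite /= -[leLHS]expR0 ler_expR; lra.
apply: (@le_trans _ _ (expR 1 * expR (stage k.+1) * expR (2 * stage k))).
  have h := inner_weight_le k.
  rewrite [cloud_weight k.+1]/=; apply: ler_pM => //.
  - by rewrite mulr_ge0 ?expR_ge0 ?(ltW rho_gt0).
  - exact: ltW (inner_weight_gt0 k).
  - rewrite ler_wpM2r ?expR_ge0//; exact: le_trans rho_le2 expR1_ge2.
rewrite -!expRD ler_expR; have := stageS k; have := stage_ge8 k; lra.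
Qed.

Definition cloud_site k : R := 2 * stage k.

Lemma site_ge0 k : 0 <= cloud_site k.
Proof. by rewrite mulr_ge0// ltW ?stage_gt0. Qed.

Lemma weight_site_le k :
  cloud_weight k * expR (- (2 * cloud_site k)) <= expR (- (2 * stage k)).
Proof.
rewrite -ler_pdivlMr ?expR_gt0// -expRN opprK -expRD.
by apply: (le_trans (weight_le k)); rewrite ler_expR /cloud_site; lra.
Qed.

Lemma summable_weight_site :
  abs_summable (fun k => cloud_weight k * expR (- (2 * cloud_site k))).
Proof.
apply: (@abs_summable_le _ _ (fun n => expR (- n%:R))); last first.
  exact: abs_summable_expN.
move=> k; rewrite ger0_norm ?mulr_ge0 ?weight_ge0 ?expR_ge0//.
apply: (le_trans (weight_site_le k)); rewrite ler_expR.
by have := stage_ge_nat k; have := stage_gt0 k; lra.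
Qed.

Local Notation superpose := (superpose cloud_weight cloud_site).

(** Three groups of clouds: up to index [k] the integrand is nearly the constant
    [l0], at index [k.+1] it is nearly an exponential on each side, and further
    out it is negligible. By the choice of [rho], the three constants appear
    with the same factor. *)
Lemma super_stage k (phi : R -> R) (l0 lp lm eps B : R) :
  rapid_by phi B -> 0 <= eps ->
  (forall c, `|c| <= 2 * stage k -> tame_at (fun y => phi y - l0) c eps) ->
  tame_at (fun y => expR (stage k.+1) * phi y - lp * expR
    (- (y - cloud_site k.+1)))
    (cloud_site k.+1) eps ->
  tame_at (fun y => expR (stage k.+1) * phi y - lm * expR
    (y - - cloud_site k.+1))
    (- cloud_site k.+1) eps ->
  `|superpose phi - 2 * mass * inner_weight k * (l0 + (lp + lm))| <=
  12 * geometric_mass R * eps * inner_weight k +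
  4 * geometric_mass R ^+ 2 * B * expR (- stage k.+2).
Proof.
move=> rphi eps0 hc hp hm.
have rapid_phi : rapid phi by exists B.
have B0 := rapid_by_ge0 rphi.
have sphi := summable_super weight_ge0 site_ge0 summable_weight_site rapid_phi.
have W1 := inner_weight_ge1 k.
have g0 := geometric_mass_gt0 R.
have tphi c : tame phi c by exact: rapid_tame.
have tcst c r : tame (fun=> r : R) c.
  by have := tameZ r (tame_cst c); under eq_fun do rewrite mulr1.
rewrite /superpose (tsum_split k.+2 sphi) big_nat_recr//=.
set S0 := \sum_(_ <= _ < _) _; set S1 := superpose_term _ _ _ _; set S2 := tsum
  _.
have h0 : `|S0 - 2 * mass * inner_weight k * l0| <=
    4 * geometric_mass R * eps * inner_weight k.
  rewrite -inner_weightE !mulr_sumr mulr_suml -sumrB.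
  apply: (le_trans (ler_norm_sum _ _ _)); rewrite !big_nat.
  apply: ler_sum => j /= jk; rewrite /superpose_term.
  have sj : cloud_site j <= 2 * stage k by rewrite ler_wpM2l// stage_le.
  have hcl c : `|c| <= 2 * stage k ->
      `|cloud phi c - l0 * mass| <= 2 * geometric_mass R * eps.
    move=> /hc; have -> : cloud phi c - l0 * mass = cloud (fun y => phi y - l0)
      c.
      have -> : (fun y => phi y - l0) = (fun y => phi y - l0 * 1).
        by apply/funext => y; rewrite mulr1.
      by rewrite (cloudB (tphi c) (tameZ l0 (tame_cst c)))
        (cloudZ l0 (tame_cst c)).
    exact: cloud_norm_bound.
  have h1 : `|cloud phi (cloud_site j) - l0 * mass| <= 2 * geometric_mass R *
    eps.
    by apply: hcl; rewrite ger0_norm ?site_ge0.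
  have h2 : `|cloud phi (- cloud_site j) - l0 * mass| <= 2 * geometric_mass R *
    eps.
    by apply: hcl; rewrite normrN ger0_norm ?site_ge0.
  have -> : cloud_weight j *
    (cloud phi (cloud_site j) + cloud phi (- cloud_site j)) -
      2 * mass * cloud_weight j * l0 = cloud_weight j *
      ((cloud phi (cloud_site j) - l0 * mass) +
        (cloud phi (- cloud_site j) - l0 * mass)).
    by ring.
  have -> : 4 * geometric_mass R * eps * cloud_weight j =
    cloud_weight j * (2 * geometric_mass R * eps + 2 * geometric_mass R * eps)
      by ring.
  rewrite normrM ger0_norm ?weight_ge0// ler_wpM2l ?weight_ge0//.
  by apply: (le_trans (ler_normD _ _)); exact: lerD.
have h1 : `|S1 - 2 * mass * inner_weight k * (lp + lm)| <=
    8 * geometric_mass R * eps * inner_weight k.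
  have e1 : `|expR (stage k.+1) * cloud phi (cloud_site k.+1) - lp *
    tilted_mass| <=
      2 * geometric_mass R * eps.
    rewrite -(cloud_expN (cloud_site k.+1)) -!cloudZ;
      [|exact: tame_expN|exact: tphi].
    rewrite -cloudB; [exact: cloud_norm_bound|exact: tameZ|].
    exact/tameZ/tame_expN.
  have e2 : `|expR (stage k.+1) * cloud phi (- cloud_site k.+1) - lm *
    tilted_mass| <=
      2 * geometric_mass R * eps.
    rewrite -(cloud_expP (- cloud_site k.+1)) -!cloudZ;
      [|exact: tame_expP|exact: tphi].
    rewrite -cloudB; [exact: cloud_norm_bound|exact: tameZ|].
    exact/tameZ/tame_expP.
  have -> : S1 - 2 * mass * inner_weight k * (lp + lm) = rho * inner_weight k *
    ((expR (stage k.+1) * cloud phi (cloud_site k.+1) - lp * tilted_mass) +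
     (expR (stage k.+1) * cloud phi (- cloud_site k.+1) - lm * tilted_mass)).
    rewrite /S1 /superpose_term [cloud_weight k.+1]/= /rho.
    set c1 := cloud _ _; set c2 := cloud _ _; set e := expR _.
    by field; rewrite gt_eqF ?tilted_gt0.
  have -> : 8 * geometric_mass R * eps * inner_weight k = (2 * inner_weight k) *
    (2 * geometric_mass R * eps + 2 * geometric_mass R * eps) by ring.
  rewrite normrM; apply: ler_pM => //.
    rewrite ger0_norm; last by rewrite mulr_ge0 ?(ltW rho_gt0)//; lra.
    by rewrite ler_wpM2r ?rho_le2//; lra.
  by apply: (le_trans (ler_normD _ _)); exact: lerD.
have h2 : `|S2| <= 4 * geometric_mass R ^+ 2 * B * expR (- stage k.+2).
  have -> : 4 * geometric_mass R ^+ 2 * B * expR (- stage k.+2) =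
    (4 * geometric_mass R * B * expR (- stage k.+2)) * tsum
      (fun n => expR (- n%:R)).
    by rewrite -/(geometric_mass R); ring.
  rewrite -tsumZ; last exact: abs_summable_expN.
  apply: norm_tsum_le; last exact/abs_summableZ/abs_summable_expN.
  move=> n; case: ltnP => [_|kn].
    by rewrite normr0 !mulr_ge0 ?expR_ge0// ltW.
  apply: (le_trans (super_term_le weight_ge0 site_ge0 n rphi)).
  rewrite -[leRHS]mulrA ler_wpM2l//; first by rewrite !mulr_ge0// ltW.
  apply: (le_trans (weight_site_le n)); rewrite -expRD ler_expR.
  by have := stage_le kn; have := stage_ge_nat n; lra.
have -> : S0 + S1 + S2 - 2 * mass * inner_weight k * (l0 + (lp + lm)) =
  (S0 - 2 * mass * inner_weight k * l0) +
  (S1 - 2 * mass * inner_weight k * (lp + lm)) + S2 by ring.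
apply: (le_trans (ler_normD _ _)); apply: lerD => //.
apply: (le_trans (ler_normD _ _)); apply: (le_trans (lerD h0 h1)).
by lra.
Qed.

End Weights.

(** * The flow at the successive stages *)

Section Stages.
Variable R : realType.
Implicit Types (s x r T t S z : R) (k n : nat).

(** The functions whose superpositions are [heat0] and [heat1]. *)
Definition hker0 t z : R := gker 0 t z.
Definition hker1 t z : R := - (2 * t)^-1 * gker 1 t z.

Lemma hker1E t z : hker1 t z = - (z / (2 * t)) * hker0 t z.
Proof. by rewrite /hker1 /hker0 /gker expr1 expr0; ring. Qed.

Lemma hker0N t z : hker0 t (- z) = hker0 t z.
Proof. by rewrite /hker0 /gker !expr0 sqrrN. Qed.

Lemma hker1N t z : hker1 t (- z) = - hker1 t z.
Proof. by rewrite !hker1E hker0N !mulNr opprK. Qed.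

Lemma hker0_ge0 t z : 0 <= hker0 t z.
Proof. exact: ltW (gker0_gt0 t z). Qed.

Lemma hker0_near1 t z : 0 < t -> `|hker0 t z - 1| <= z ^+ 2 / (4 * t).
Proof.
move=> t0; rewrite /hker0 /gker expr0 mul1r; set q := z ^+ 2 / _.
have q0 : 0 <= q by rewrite divr_ge0 ?sqr_ge0// mulr_ge0// ltW.
have := expR_ge1Dx (- q); have : expR (- q) <= 1 by rewrite -[leRHS]expR0
  ler_expR oppr_le0.
by move=> h1 h2; rewrite ler_norml; apply/andP; split; lra.
Qed.

(** Completing the square around the exponential limit. *)
Lemma wing_exponent s x r T : 0 < T + s ->
  expR T * hker0 (T + s) (x - (2 * T + r)) =
  expR (s + x - r) * expR (- ((s - (r - x) / 2) ^+ 2 / (T + s))).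
Proof.
move=> t0; rewrite /hker0 /gker expr0 mul1r -!expRD; congr expR.
by field; rewrite gt_eqF.
Qed.

Lemma growth_le S n : 1 <= S -> S + n%:R / 2 <= S * expR (n%:R / 2).
Proof.
move=> S1; apply: (@le_trans _ _ (S * (1 + n%:R / 2))).
  by rewrite mulrDr mulr1 lerD2l ler_peMl// divr_ge0.
by rewrite ler_wpM2l ?expR_ge1Dx//; lra.
Qed.

(** In [wing_exponent] the second exponential is close to 1. For [hker1] the
    additional factor [- z / (2 t)] is close to 1 as well, since the distance
    from [x] to the cloud is close to twice the time. *)
Lemma wing_le s x r T S n : 0 < T + s -> `|r| <= n%:R -> `|s| + `|x| + 1 <= S ->
  `|expR T * hker0 (T + s) (x - (2 * T + r)) - expR (s + x) * expR (- r)| <=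
    expR S * S ^+ 2 / (T + s) * expR (2 * n%:R) /\
  `|expR T * hker1 (T + s) (x - (2 * T + r)) - expR (s + x) * expR (- r)| <=
    2 * (expR S * S ^+ 2) / (T + s) * expR (2 * n%:R).
Proof.
move=> t0 rn sxS; have [s0 x0] := (normr_ge0 s, normr_ge0 x).
have S1 : 1 <= S by lra.
have n0 := ler0n R n.
have /andP[r1 r2] : - n%:R <= r <= n%:R by rewrite -ler_norml.
have x1 := ler_norm x; have x2 := ler_norm (- x); rewrite normrN in x2.
have s1 := ler_norm s; have s2 := ler_norm (- s); rewrite normrN in s2.
pose q := (s - (r - x) / 2) ^+ 2 / (T + s).
have q0 : 0 <= q by rewrite divr_ge0 ?sqr_ge0// ltW.
have qle : q <= S ^+ 2 / (T + s) * expR n%:R.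
  rewrite /q [leRHS]mulrAC ler_wpM2r ?invr_ge0 ?(ltW t0)//.
  have -> : expR n%:R = expR (n%:R / 2) ^+ 2 :> R.
    by rewrite -expRM_natl; congr expR; field.
  rewrite -exprMn -[X in X <= _]real_normK ?num_real//.
  apply: lerXn2r; rewrite ?nnegrE ?normr_ge0//.
    by rewrite mulr_ge0 ?expR_ge0//; lra.
  apply: le_trans (growth_le n S1).
  by rewrite ler_norml; apply/andP; split; lra.
have aE : expR (s + x - r) <= expR S * expR n%:R.
  by rewrite -expRD ler_expR; lra.
have a0 := expR_ge0 (s + x - r).
have e2n : expR (2 * n%:R) = expR n%:R * expR n%:R :> R.
  by rewrite -expRD; congr expR; ring.
have exp1 : expR (- q) <= 1 by rewrite -[leRHS]expR0 ler_expR oppr_le0.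
have expq : 1 - q <= expR (- q) by exact: expR_ge1Dx.
have E0 := wing_exponent x r t0; rewrite -/q in E0.
have Ea : expR (s + x) * expR (- r) = expR (s + x - r) by rewrite -expRD.
have bound0 : `|expR T * hker0 (T + s) (x - (2 * T + r)) -
    expR (s + x) * expR (- r)| <= expR S * S ^+ 2 / (T + s) * expR (2 * n%:R).
  rewrite Ea E0 -[X in _ - X]mulr1 -mulrBr normrM (ger0_norm a0).
  have -> : expR S * S ^+ 2 / (T + s) * expR (2 * n%:R) =
     (expR S * expR n%:R) * (S ^+ 2 / (T + s) * expR n%:R) by rewrite e2n; ring.
  apply: ler_pM => //; apply: le_trans qle.
  by rewrite ler_norml; apply/andP; split; lra.
split=> //.
have -> : expR T * hker1 (T + s) (x - (2 * T + r)) -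
    expR (s + x) * expR (- r) =
  (expR T * hker0 (T + s) (x - (2 * T + r)) - expR (s + x) * expR (- r)) +
  (r - x - 2 * s) / (2 * (T + s)) * (expR T * hker0 (T + s) (x - (2 * T + r))).
  by rewrite hker1E; field; rewrite gt_eqF.
have -> : 2 * (expR S * S ^+ 2) / (T + s) * expR (2 * n%:R) =
  expR S * S ^+ 2 / (T + s) * expR (2 * n%:R) +
  expR S * S ^+ 2 / (T + s) * expR (2 * n%:R) by ring.
apply: (le_trans (ler_normD _ _)); apply: lerD => //.
rewrite normrM E0 (ger0_norm (mulr_ge0 a0 (expR_ge0 _))).
have -> : expR S * S ^+ 2 / (T + s) * expR (2 * n%:R) =
  (S ^+ 2 / (T + s) * expR n%:R) * (expR S * expR n%:R) by rewrite e2n; ring.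
apply: ler_pM; rewrite ?mulr_ge0 ?expR_ge0//; last first.
  by apply: le_trans aE; rewrite ler_piMr.
rewrite normrM normfV (gtr0_norm (mulr_gt0 _ t0))// invfM mulrA.
rewrite [leRHS]mulrAC ler_wpM2r ?invr_ge0 ?(ltW t0)//.
apply: (@le_trans _ _ (S + n%:R / 2)).
  rewrite ler_pdivrMr//; rewrite ler_norml; apply/andP; split; lra.
have g := growth_le n S1.
have S0 : 0 <= S by lra.
apply: (le_trans g); apply: ler_pM; rewrite ?expR_ge0//.
  by rewrite expr2 ler_peMl.
by rewrite ler_expR; lra.
Qed.

(** For [t] of order [T' ^ 3], points at distance of order [T'] are well within
    the width of the Gaussian. *)
Lemma center_le T' t x c S n : 1 <= T' -> T' ^+ 3 / 2 <= t -> `|x| + 1 <= S ->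
  `|c| <= 2 * T' + n%:R ->
  `|hker0 t (x - c) - 1| <= 5 * S ^+ 2 / T' * expR (2 * n%:R) /\
  `|hker1 t (x - c)| <= 5 * S ^+ 2 / T' * expR (2 * n%:R).
Proof.
move=> T1 Tt xS cT; have x0 := normr_ge0 x; have n0 := ler0n R n.
have S1 : 1 <= S by lra.
have T0 : 0 < T' by lra.
have T30 : 0 < T' ^+ 3 by rewrite exprn_gt0.
have t0 : 0 < t by lra.
pose M := 3 * T' * S * expR n%:R.
have zM : `|x - c| <= M.
  apply: (le_trans (ler_normB _ _)).
  apply: (@le_trans _ _ (3 * T' * S * (1 + n%:R))).
    have TS : 1 <= T' * S by rewrite -[1]mulr1 ler_pM.
    have h1 : S <= T' * S by rewrite ler_peMl//; lra.
    have h2 : T' <= T' * S by rewrite ler_peMr//; lra.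
    have h3 : n%:R <= T' * S * n%:R by rewrite ler_peMl.
    have -> : 3 * T' * S * (1 + n%:R) = 3 * (T' * S) + 3 * (T' * S * n%:R) by
      ring.
    set m := T' * S * n%:R in h3 *; set p := T' * S in TS h1 h2 *; lra.
  by rewrite ler_wpM2l ?expR_ge1Dx// !mulr_ge0//; lra.
have M0 : 0 <= M by apply: le_trans zM.
have e2n : expR (2 * n%:R) = expR n%:R ^+ 2 :> R by rewrite -expRM_natl.
have e1 : 1 <= expR n%:R :> R by rewrite -[leLHS]expR0 ler_expR.
have tinv : t^-1 <= 2 * (T' ^+ 3)^-1.
  have -> : 2 * (T' ^+ 3)^-1 = (T' ^+ 3 / 2)^-1 by field; rewrite gt_eqF.
  by rewrite lef_pV2 ?posrE ?divr_gt0.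
split.
  apply: (le_trans (hker0_near1 _ t0)).
  apply: (@le_trans _ _ (M ^+ 2 / 4 * (2 * (T' ^+ 3)^-1))).
    rewrite invfM mulrA; apply: ler_pM => //.
    - by rewrite divr_ge0 ?sqr_ge0.
    - by rewrite invr_ge0 ltW.
    - rewrite ler_wpM2r// -[X in X <= _]real_normK ?num_real//.
      by apply: lerXn2r; rewrite ?nnegrE.
  have -> : M ^+ 2 / 4 * (2 * (T' ^+ 3)^-1) =
     (9 / 2) * (S ^+ 2 / T' * expR n%:R ^+ 2) by rewrite /M; field; rewrite
       gt_eqF.
  have -> : 5 * S ^+ 2 / T' * expR (2 * n%:R) =
    5 * (S ^+ 2 / T' * expR n%:R ^+ 2) by rewrite e2n; ring.
  rewrite ler_wpM2r//; last by lra.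
  by rewrite mulr_ge0 ?sqr_ge0// divr_ge0 ?sqr_ge0// ltW.
rewrite hker1E mulNr normrN normrM.
have h01 : `|hker0 t (x - c)| <= 1.
  rewrite (ger0_norm (hker0_ge0 _ _)) /hker0 /gker expr0 mul1r -[leRHS]expR0
    ler_expR.
  by rewrite oppr_le0 divr_ge0 ?sqr_ge0// mulr_ge0// ltW.
apply: (@le_trans _ _ (`|(x - c) / (2 * t)|)); first by rewrite ler_piMr.
rewrite normrM normfV (gtr0_norm (mulr_gt0 _ t0))// invfM.
apply: (@le_trans _ _ (M * (2^-1 * (2 * (T' ^+ 3)^-1)))).
  apply: ler_pM => //; first by rewrite mulr_ge0 ?invr_ge0// ltW.
  by rewrite ler_wpM2l.
have -> : M * (2^-1 * (2 * (T' ^+ 3)^-1)) =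
   (3 * S * expR n%:R / T') * T'^-1 by rewrite /M; field; rewrite gt_eqF.
have iT : 0 < T'^-1 by rewrite invr_gt0.
have iT1 : T'^-1 <= 1 by rewrite invf_le1.
have P0 : 0 <= 3 * S * expR n%:R / T'.
  by rewrite !mulr_ge0 ?expR_ge0 ?ltW//; lra.
apply: (@le_trans _ _ (3 * S * expR n%:R / T')); first by rewrite ler_piMr.
have -> : 5 * S ^+ 2 / T' * expR (2 * n%:R) = (5 * S ^+ 2 * expR n%:R ^+ 2) /
  T'.
  by rewrite e2n; ring.
rewrite ler_wpM2r ?(ltW iT)//.
have h1 : S <= S ^+ 2 by rewrite expr2 ler_peMl//; lra.
have h2 : expR n%:R <= expR n%:R ^+ 2 :> R.
  by rewrite expr2 ler_peMl ?expR_ge0.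
have S0 : 0 <= S by lra.
apply: ler_pM; rewrite ?expR_ge0 ?mulr_ge0//; lra.
Qed.

Local Notation superpose := (superpose (@cloud_weight R) (@cloud_site R)).

Lemma hker_rapid_by t x X S : 1 <= t -> `|x| <= S -> X = expR (25 * t + 2 * S)
  ->
  rapid_by (fun y => hker0 t (x - y)) X /\ rapid_by (fun y => hker1 t (x - y))
    X.
Proof.
move=> t1 xS ->; have t0 : 0 < t by lra.
have eB : expR (25 * t) * expR (2 * `|x|) <= expR (25 * t + 2 * S).
  by rewrite -expRD ler_expR; lra.
split=> y.
  apply: (le_trans (gker_rapid_by 0 x t0 y)).
  by rewrite /gker_bound expr0 mul1r ler_wpM2r ?expR_ge0.
rewrite /hker1 mulNr normrN normrM ger0_norm; last by rewrite invr_ge0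
  mulr_ge0// ltW.
apply: (@le_trans _ _ (1 * `|gker 1 t (x - y)|)).
  by rewrite ler_wpM2r// invf_le1; lra.
rewrite mul1r; apply: (le_trans (gker_rapid_by 1 x t0 y)).
by rewrite /gker_bound expr1 mul1r ler_wpM2r ?expR_ge0.
Qed.

Definition stage_err S : R := 60 * geometric_mass R * expR S * S ^+ 2 + 4 *
  geometric_mass R ^+ 2.

(** The superposition at time [stage k.+1 + s], divided by
    [2 * mass * inner_weight k], reproduces the three exponentials of the merger
    at time [s]. *)
Lemma stage_estimate s x S k : `|s| + `|x| + 1 <= S -> 2 * S <= stage R k ->
  let t := stage R k.+1 + s in let D := inner_weight R k in
  `|superpose (fun y => hker0 t (x - y)) - 2 * mass R * D * merger0 s x| <=
    stage_err S / stage R k * D /\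
  `|superpose (fun y => hker1 t (x - y)) - 2 * mass R * D * merger1 s x| <=
    stage_err S / stage R k * D.
Proof.
move=> sxS ST /=; set T := stage R k.+1; set T' := stage R k.
rewrite -/T' in ST.
have TT : 64 * T' <= T by exact: stageS.
have T8 : 8 <= T' by exact: stage_ge8.
have [s0 x0] := (normr_ge0 s, normr_ge0 x).
have S1 : 1 <= S by lra.
have S0 : 0 <= S by lra.
have sS : `|s| <= S by lra.
have xS : `|x| <= S by lra.
have xS1 : `|x| + 1 <= S by lra.
have /andP[s1 s2] : - S <= s <= S by rewrite -ler_norml.
have ht : T / 2 <= T + s by lra.
have t2 : T + s <= 2 * T by lra.
have t0 : 0 < T + s by lra.
have t1 : 1 <= T + s by lra.
have T0 : 0 < T by lra.
have T'0 : 0 < T' by lra.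
have g0 := geometric_mass_gt0 R.
have D1 := inner_weight_ge1 R k.
have [rap0 rap1] := hker_rapid_by t1 xS erefl.
set B := expR _ in rap0 rap1.
(* The kernel decays exponentially beyond distances of order [T], and the next
   clouds are at least 64 times farther. *)
have Bsmall : B * expR (- stage R k.+2) <= T'^-1.
  rewrite /B -expRD; apply: (@le_trans _ _ (expR (- T'))).
    by rewrite ler_expR; have := stageS R k.+1; rewrite -/T; lra.
  rewrite expRN lef_pV2 ?posrE ?expR_gt0//.
  by have := expR_ge1Dx T'; lra.
pose eps := 5 * expR S * S ^+ 2 / T'.
have eS : 1 <= expR S by rewrite -[leLHS]expR0 ler_expR.
have S20 : 0 <= S ^+ 2 by exact: sqr_ge0.
have eps0 : 0 <= eps.
  by rewrite /eps !mulr_ge0 ?invr_ge0 ?expR_ge0// ltW.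
have final : 12 * geometric_mass R * eps * inner_weight R k +
    4 * geometric_mass R ^+ 2 * B * expR (- stage R k.+2) <=
    stage_err S / T' * inner_weight R k.
  have -> : stage_err S / T' * inner_weight R k =
    12 * geometric_mass R * eps * inner_weight R k +
    4 * geometric_mass R ^+ 2 * (T'^-1 * inner_weight R k) by rewrite /stage_err
      /eps; ring.
  rewrite lerD2l -mulrA ler_wpM2l ?mulr_ge0 ?(ltW g0)//.
  by apply: (le_trans Bsmall); rewrite ler_peMr// invr_ge0 ltW.
have T3 : T' ^+ 3 / 2 <= T + s by exact: ht.
have ceps n : 5 * S ^+ 2 / T' * expR (2 * n%:R) <= eps * expR (2 * n%:R).
  rewrite ler_wpM2r ?expR_ge0// /eps ler_wpM2r ?invr_ge0 ?(ltW T'0)//.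
  by rewrite ler_wpM2r// ler_peMr.
have iT : (T + s)^-1 <= 2 * T'^-1.
  have -> : 2 * T'^-1 = (T' / 2)^-1 by field; rewrite gt_eqF.
  by rewrite lef_pV2 ?posrE ?divr_gt0//; lra.
have weps n : 2 * (expR S * S ^+ 2) / (T + s) * expR (2 * n%:R) <=
    eps * expR (2 * n%:R).
  rewrite ler_wpM2r ?expR_ge0//.
  apply: (@le_trans _ _ (2 * (expR S * S ^+ 2) * (2 * T'^-1))).
    by rewrite ler_wpM2l// !mulr_ge0 ?expR_ge0.
  have -> : 2 * (expR S * S ^+ 2) * (2 * T'^-1) = 4 * (expR S * S ^+ 2 / T') by
    ring.
  have -> : eps = 5 * (expR S * S ^+ 2 / T') by rewrite /eps; ring.
  by rewrite ler_wpM2r ?mulr_ge0 ?expR_ge0 ?invr_ge0 ?(ltW T'0)//; lra.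
have weps' n : expR S * S ^+ 2 / (T + s) * expR (2 * n%:R) <=
    eps * expR (2 * n%:R).
  apply: le_trans (weps n); rewrite ler_wpM2r ?expR_ge0//.
  rewrite -[X in _ <= X]mulrA ler_peMl//; last by lra.
  by rewrite !mulr_ge0 ?expR_ge0 ?invr_ge0 ?(ltW t0).
have cn c n : `|c| <= 2 * T' -> `|c + n%:R| <= 2 * T' + n%:R /\
    `|c - n%:R| <= 2 * T' + n%:R.
  move=> cT; have nn : `|n%:R| = n%:R :> R by rewrite ger0_norm.
  by split; [have := ler_normD c n%:R|have := ler_normB c n%:R]; rewrite nn;
    lra.
have nr n : `|n%:R| <= n%:R :> R by rewrite ger0_norm.
have nrN n : `|- n%:R| <= n%:R :> R by rewrite normrN ger0_norm.
have sxS' : `|s| + `|- x| + 1 <= S by rewrite normrN.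
have right (y z : R) n : y = cloud_site R k.+1 + z -> `|z| <= n%:R ->
  `|expR T * hker0 (T + s) (x - y) - expR (s + x) * expR
    (- (y - cloud_site R k.+1))| <=
    eps * expR (2 * n%:R) /\
  `|expR T * hker1 (T + s) (x - y) - expR (s + x) * expR
    (- (y - cloud_site R k.+1))| <=
    eps * expR (2 * n%:R).
  move=> -> zn; have -> : - (cloud_site R k.+1 + z - cloud_site R k.+1) = - z by
    ring.
  have [h1 h2] := wing_le t0 zn sxS.
  by split; [apply: le_trans (weps' n)|apply: le_trans (weps n)].
have left (y z : R) n : y = - cloud_site R k.+1 - z -> `|z| <= n%:R ->
  `|expR T * hker0 (T + s) (x - y) - expR (s - x) * expR
    (y - - cloud_site R k.+1)| <=
    eps * expR (2 * n%:R) /\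
  `|expR T * hker1 (T + s) (x - y) - - expR (s - x) * expR
    (y - - cloud_site R k.+1)| <=
    eps * expR (2 * n%:R).
  move=> -> zn; have -> : - cloud_site R k.+1 - z - - cloud_site R k.+1 = - z by
    ring.
  have -> : x - (- cloud_site R k.+1 - z) = - (- x - (2 * T + z)) by rewrite
    /cloud_site -/T; ring.
  have [h1 h2] := wing_le t0 zn sxS'; rewrite hker0N hker1N.
  split; first exact: le_trans (weps' n).
  by rewrite mulrN mulNr -opprD normrN; exact: le_trans (weps n).
have m0E : merger0 s x = 1 + (expR (s + x) + expR (s - x)).
  by rewrite /merger0 mulrDr -!expRD.
have m1E : merger1 s x = 0 + (expR (s + x) + - expR (s - x)).
  by rewrite /merger1 add0r mulrBr -!expRD.
rewrite m0E m1E; split.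
  apply: le_trans final; apply: super_stage => //.
  - move=> c /cn cn' n; have [c1 c2] := cn' n.
    by split; apply: le_trans (ceps n); [have [] := center_le _ T3 xS1 c1|
      have [] := center_le _ T3 xS1 c2]; lra.
  - move=> n; split; first by have [] := right _ _ n erefl (nr n).
    by have [] := right _ _ n erefl (nrN n).
  - move=> n; split; last by have [] := left _ _ n erefl (nr n).
    by have [] := left (- cloud_site R k.+1 + n%:R) (- n%:R) n _ (nrN n);
      rewrite ?opprK.
apply: le_trans final; apply: super_stage => //.
- move=> c /cn cn' n; have [c1 c2] := cn' n; rewrite !subr0.
  by split; apply: le_trans (ceps n); [have [] := center_le _ T3 xS1 c1|
    have [] := center_le _ T3 xS1 c2]; lra.
- move=> n; split; first by have [] := right _ _ n erefl (nr n).
  by have [] := right _ _ n erefl (nrN n).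
- move=> n; split; last by have [] := left _ _ n erefl (nr n).
  by have [] := left (- cloud_site R k.+1 + n%:R) (- n%:R) n _ (nrN n); rewrite
    ?opprK.
Qed.

Lemma ratio_close (G m0 m1 a0 a1 eta : R) : 0 < G -> 1 <= m0 -> `|m1| <= m0 ->
  eta <= 2^-1 -> `|a0 - G * m0| <= eta * G -> `|a1 - G * m1| <= eta * G ->
  `|a1 / a0 - m1 / m0| <= 4 * eta.
Proof.
move=> G0 m01 m1m eta2 h0 h1.
have eta0 : 0 <= eta by rewrite -(pmulr_lge0 _ G0) (le_trans _ h0).
have m00 : 0 < m0 by lra.
have a0G : G / 2 <= a0.
  move: h0; rewrite ler_distl => /andP[h _].
  by apply: le_trans h; nra.
have a00 : 0 < a0 by apply: lt_le_trans a0G; rewrite divr_gt0.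
have -> : a1 / a0 - m1 / m0 = ((a1 - G * m1) * m0 - m1 * (a0 - G * m0)) /
  (a0 * m0).
  by field; rewrite !gt_eqF.
rewrite normrM normfV (gtr0_norm (mulr_gt0 a00 m00)) ler_pdivrMr ?mulr_gt0//.
apply: (le_trans (ler_normB _ _)); rewrite !normrM (gtr0_norm m00).
apply: (@le_trans _ _ (eta * G * m0 + m0 * (eta * G))).
  by apply: lerD; [rewrite ler_wpM2r// ltW|exact: ler_pM].
have -> : eta * G * m0 + m0 * (eta * G) = 4 * eta * ((G / 2) * m0) by field.
by rewrite ler_wpM2l ?mulr_ge0// ler_wpM2r// ltW.
Qed.

Lemma superflow_near_merger s S x k : `|s| + `|x| + 1 <= S -> 2 * S <= stage R k
  ->
  stage_err S / mass R <= stage R k ->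
  `|superflow (@cloud_weight R) (@cloud_site R) (stage R k.+1 + s - 1) x
    - merger s x| <=
  4 * stage_err S / mass R / stage R k.
Proof.
move=> sxS ST small; have T0 := stage_gt0 R k.
have m0 := mass_gt0 R; have D0 := inner_weight_gt0 R k.
have [h0 h1] := stage_estimate sxS ST.
have tE : 1 + (stage R k.+1 + s - 1) = stage R k.+1 + s by ring.
have t0 : 0 < stage R k.+1 + s.
  have := stageS R k; have := ler_norm (- s); rewrite normrN.
  by have := normr_ge0 x; lra.
set G := 2 * mass R * inner_weight R k in h0 h1.
have G0 : 0 < G by rewrite !mulr_gt0.
pose eta := stage_err S / mass R / stage R k / 2.
have etaG : stage_err S / stage R k * inner_weight R k = eta * G.
  by rewrite /eta /G; field; rewrite !gt_eqF.
rewrite etaG in h0 h1.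
have m1m : `|merger1 s x| <= merger0 s x.
  rewrite /merger1 normrM ger0_norm ?expR_ge0//.
  apply: (@le_trans _ _ (expR s * (expR x + expR (- x)))); last by rewrite
    lerDr.
  rewrite ler_wpM2l ?expR_ge0// (le_trans (ler_normB _ _))//.
  by rewrite !ger0_norm ?expR_ge0.
have eta2 : eta <= 2^-1.
  by rewrite /eta ler_pdivrMr// mulVf ?pnatr_eq0// ler_pdivrMr// mul1r.
have := ratio_close G0 (ltW (merger0_gt1 s x)) m1m eta2 h0 h1.
set u := superflow _ _ _ _.
have -> : u = - 2 * (superpose (fun y => hker1 (stage R k.+1 + s) (x - y)) /
    superpose (fun y => hker0 (stage R k.+1 + s) (x - y))).
  have -> : superpose (fun y => hker1 (stage R k.+1 + s) (x - y)) =
      heat1 (@cloud_weight R) (@cloud_site R) (stage R k.+1 + s - 1) x.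
    rewrite /heat1 tE; apply: superZ; [exact: weight_ge0|exact: site_ge0|
      exact: summable_weight_site|exact: gker_rapid].
  by rewrite mulrA /u /superflow /heat0 tE.
have -> : merger s x = - 2 * (merger1 s x / merger0 s x) by rewrite mulrA.
rewrite -mulrBr normrM normrN (ger0_norm (ler0n _ 2)).
move=> h; apply: (@le_trans _ _ (2 * (4 * eta))); first by rewrite ler_wpM2l.
by rewrite /eta; lra.
Qed.

End Stages.

(** * The initial datum and its omega-limit set *)

Section WeakStar.
Variable R : realType.

Lemma right_norm_le (d : R) : 0 < d -> \forall s \near 0^'+, `|s| <= d.
Proof.
move=> d0; near=> s; rewrite ger0_norm//.
by near: s; exact: nbhs_right_le.
Unshelve. all: by end_near. Qed.

(** Uniform convergence is paired with an integrable function at the cost of the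
    norm of that function in L^1. *)
Lemma weak_star_of_uniform (u : R -> R -> R) (C d : R) : 0 < d ->
  (forall s, `|s| <= d -> measurable_fun setT (u s)) ->
  (forall s x, `|s| <= d -> `|u s x| <= C /\ `|u s x - u 0 x| <= C * `|s|) ->
  weak_star_cvg0 u (u 0).
Proof.
move=> d0 mu H g /Lfun1_integrable ig.
have d00 : `|0 : R| <= d by rewrite normr0 ltW.
have iu s : `|s| <= d ->
    (@lebesgue_measure R).-integrable setT (EFin \o (fun x => u s x * g x)).
  move=> sd; have bd : [bounded u s x | x in setT].
    exists C; split; first exact: num_real.
    move=> y Cy x _; apply: le_trans (ltW Cy); exact: (H s x sd).1.
  have := @integrableMr _ (measurableTypeR R) R lebesgue_measure setT
    measurableT (u s) (EFin \o g) (mu s sd) bd ig.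
  by apply: eq_integrable.
have C0 : 0 <= C by have [h _] := H 0 0 d00; apply: le_trans h.
have iN : (@lebesgue_measure R).-integrable setT (EFin \o (fun x => `|g x|)).
  exact: integrable_norm.
set K := \int[@lebesgue_measure R]_x `|g x|.
have K0 : 0 <= K by exact: Rintegral_ge0.
apply/cvgrPdist_le => e e0.
have e1 : 0 < e / (C * K + 1) by rewrite divr_gt0// ltr_wpDl// mulr_ge0.
near=> s.
have sd : `|s| <= d.
  near: s; exact: right_norm_le.
have se : `|s| <= e / (C * K + 1).
  near: s; exact: right_norm_le.
rewrite distrC -RintegralB//; [|exact: iu..].
apply: (le_trans (le_normr_Rintegral _ _)) => //.
  have := integrableB measurableT (iu s sd) (iu 0 d00).
  by apply: eq_integrable.
apply: (@le_trans _ _ (\int[@lebesgue_measure R]_x (C * `|s| * `|g x|))).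
  apply: le_Rintegral => //.
  - apply: integrable_norm.
    have := integrableB measurableT (iu s sd) (iu 0 d00).
    by apply: eq_integrable.
  - by have := @integrableZl _ _ _ _ setT measurableT (C * `|s|) _ iN; apply:
    eq_integrable.
  - by move=> x _; rewrite -mulrBl normrM ler_wpM2r//; exact: (H s x sd).2.
rewrite RintegralZl// -/K.
apply: (@le_trans _ _ ((C * K + 1) * `|s|)).
  by rewrite mulrAC ler_wpM2r// lerDl.
by rewrite mulrC -ler_pdivlMr// ltr_wpDl// mulr_ge0.
Unshelve. all: by end_near. Qed.

End WeakStar.

Section InitialDatum.
Variable R : realType.

Lemma burgers_solution_subset (I J : set R) (u : R -> R -> R) : J `<=` I ->
  burgers_solution I u -> burgers_solution J u.
Proof.
move=> JI [h1 h2 h3 h4]; split.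
- by move=> t x /JI; exact: h1.
- by move=> t x /JI; exact: h2.
- by move=> t /JI; exact: h3.
- by move=> t /JI; exact: h4.
Qed.

Lemma near_stage_ge (A : R) : \forall k \near \oo, A <= stage R k.
Proof.
near=> k; apply: le_trans (stage_ge_nat R k).
by near: k; exact: nbhs_infty_ger.
Unshelve. all: by end_near. Qed.

Local Notation flow := (superflow (@cloud_weight R) (@cloud_site R)).

Lemma flow_burgers : burgers_solution [set t : R | -1 < t] flow /\
  lipschitz_in_time [set t : R | -1 < t] flow.
Proof.
apply: superflow_burgers; [exact: weight_ge0|exact: ltr01|exact: site_ge0|].
exact: summable_weight_site.
Qed.

Lemma flow_from_initial_datum : burgers_flow (flow 0) flow.
Proof.
have [sol lip] := flow_burgers; split.
  apply: burgers_solution_subset sol => t /=.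
  by rewrite in_itv/= andbT; lra.
have [C [d [d0 H]]] := lip 0 (ltrN10 R).
have [_ _ linf _] := sol.
(* The bound [2^-1] keeps the times above -1, where the flow starts. *)
have m0 : 0 < Num.min d 2^-1 by rewrite lt_min d0 invr_gt0 ltr0n.
apply: (@weak_star_of_uniform _ _ C (Num.min d 2^-1)) => //.
- move=> s; rewrite le_min => /andP[_ s2].
  have : Linfty (flow s).
    apply: linf => /=; move: s2; rewrite ler_norml => /andP[h _]; lra.
  by rewrite /Linfty inE/= => /andP[]; rewrite inE.
- move=> s x; rewrite le_min => /andP[sd _].
  by have := H s x; rewrite subr0; apply.
Qed.

Lemma merger_in_omega0 (s : R) : omega0 (flow 0) (merger s).
Proof.
split.
  by have [_ _ h _] := merger_entire R; exact: h.
(* The shift by 1 is that of the time variable in [heat0]. *)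
exists flow, (fun k => stage R k.+1 + s - 1); split.
- exact: flow_from_initial_datum.
- apply/cvgryPge => A; near=> k.
  have : A - s + 1 <= stage R k by near: k; exact: near_stage_ge.
  by have := stageS R k; have := stage_ge8 R k; lra.
- move=> a b P /uniform_nbhs [E [entE EP]].
  move: entE; rewrite -entourage_ballE => -[e /= e0 eE].
  pose S := `|s| + (`|a| + `|b|) + 1.
  near=> k; apply: EP => x /=; rewrite in_itv/= => /andP[ax xb].
  apply: eE; rewrite /ball/= distrC.
  have xS : `|s| + `|x| + 1 <= S.
    rewrite /S lerD2r lerD2l ler_norml.
    have := ler_norm (- a); have := ler_norm b; rewrite normrN.
    have := normr_ge0 a; have := normr_ge0 b => *; apply/andP; split; lra.
  have k1 : 2 * S <= stage R k by near: k; exact: near_stage_ge.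
  have k2 : stage_err S / mass R <= stage R k by near: k; exact: near_stage_ge.
  apply: le_lt_trans (superflow_near_merger xS k1 k2) _.
  rewrite ltr_pdivrMr ?stage_gt0// -ltr_pdivrMl//.
  apply: (@lt_le_trans _ _ (e^-1 * (4 * stage_err S / mass R) + 1)).
    by rewrite ltrDl.
  by near: k; exact: near_stage_ge.
Unshelve. all: by end_near. Qed.

End InitialDatum.

Theorem proposition1p4 (R : realType) :
  exists (u0 : R -> R) (v : R -> R -> R),
    [/\ Linfty u0,
        entire_solution v,
        (forall t : R, omega0 u0 (v t)),
        (forall t : R,
           ~ (exists c : R, forall x : R, v t x = c) /\
           ~ (exists alpha beta x0 : R, alpha < beta /\
                forall x : R, v t x = shock beta alpha (x - x0))) &
        shock_merger v].
Proof.
exists (superflow (@cloud_weight R) (@cloud_site R) 0), (@merger R); split.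
- by have [[_ _ h _] _] := flow_burgers R; apply: h => /=; rewrite ltrN10.
- exact: merger_entire.
- exact: merger_in_omega0.
- by move=> t; split; [exact: merger_not_cst|exact: merger_not_shock].
- exact: merger_is_shock_merger.
Qed.
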